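(* Let $E=\mathbb{Q}(\sqrt{-11})$, let $\omega=\frac{1+\sqrt{-11}}{2}$, and let $\mathfrak{O}=\mathbb{Z}[\omega]$ be the ring of integers of $E$. If a positive Hermitian $\mathfrak{O}$-lattice represents both $\langle 1,1\rangle$ and $\begin{pmatrix}2&\omega\\\overline{\omega}&2\end{pmatrix}$, then it is $2$-universal.
   Context: A Hermitian $\mathfrak{O}$-lattice is a finitely generated $\mathfrak{O}$-submodule $L$ of a finite-dimensional $E$-vector space equipped with a form $H$ that is linear in the first variable, satisfies $H(x,y)=\overline{H(y,x)}$ (bar is complex conjugation), and has $H(L,L)\subseteq\mathfrak{O}$. Its rank is $\dim_E EL$; binary means rank 2. It is positive (definite) if $H(v):=H(v,v)>0$ for all $0\neq v\in L$. Here every lattice is free ($\mathfrak{O}$ is a PID); the Gram matrix of a lattice with basis $v_1,\dots,v_n$ is $M_L=(H(v_i,v_j))$, and a lattice is identified with its Gram matrix. $\langle a_1,\dots,a_n\rangle$ denotes the lattice with diagonal Gram matrix with entries $a_1,\dots,a_n$. $L$ represents $\ell$ if $M_\ell=XM_LX^*$ for some matrix $X$ over $\mathfrak{O}$, where $X^*$ is the conjugate transpose. A positive Hermitian $\mathfrak{O}$-lattice is $2$-universal if it represents all binary positive Hermitian $\mathfrak{O}$-lattices. *)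

(* Defs.v *)
From mathcomp Require Import all_boot all_order all_algebra all_field.
Set Implicit Arguments.
Unset Strict Implicit.
Unset Printing Implicit Defensive.
Import Order.TTheory GRing.Theory Num.Theory.
Local Open Scope ring_scope.
Local Open Scope sesquilinear_scope.

(* E = Q(sqrt(-11)) is viewed inside the algebraic complex numbers; the
   principal root [sqrtC (- 11)] is i * sqrt 11, and [conjC] restricts to the
   nontrivial automorphism of E. *)
Definition omega : algC := (1 + sqrtC (- 11%:R)) / 2%:R.

(* The ring Z[omega]. *)
Definition inO (x : algC) : Prop :=
  exists p : {poly int}, x = (map_poly intr p).[omega].

Definition mx_over_O m n (A : 'M[algC]_(m, n)) : Prop :=
  forall i j, inO (A i j).

(* Z[omega] is a principal ideal domain, so every lattice is free; a lattice of
   rank n is given by its Gram matrix M in some basis, i.e. as the module of row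
   vectors over Z[omega] of length n with the form H(x, y) = x M y^*. *)
Definition herm_form n (M : 'M[algC]_n) (x y : 'rV[algC]_n) : algC :=
  (x *m M *m y ^t*) 0 0.

Definition hermitian_lattice n (M : 'M[algC]_n) : Prop :=
  mx_over_O M /\ M = M ^t*.

Definition positive_lattice n (M : 'M[algC]_n) : Prop :=
  hermitian_lattice M /\
  forall x : 'rV[algC]_n, mx_over_O x -> x != 0 -> 0 < herm_form M x x.

Definition represents n m (L : 'M[algC]_n) (l : 'M[algC]_m) : Prop :=
  exists X : 'M[algC]_(m, n), mx_over_O X /\ l = X *m L *m X ^t*.

Definition two_universal n (L : 'M[algC]_n) : Prop :=
  positive_lattice L /\
  forall l : 'M[algC]_2, positive_lattice l -> represents L l.

Definition diag_lattice n (a : 'rV[algC]_n) : 'M[algC]_n := diag_mx a.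

Definition mx22 (a b c d : algC) : 'M[algC]_2 :=
  \matrix_(i < 2, j < 2)
    if i == 0 then if j == 0 then a else b else if j == 0 then c else d.

(* Main.v *)
From mathcomp Require Import all_boot all_order all_algebra all_field.
Require Import Defs.
From Stdlib Require Import Classical.
From mathcomp Require Import fingroup perm ring zify.
Set Implicit Arguments.
Unset Strict Implicit.
Unset Printing Implicit Defensive.
Import Order.TTheory GRing.Theory Num.Theory.
Local Open Scope ring_scope.
Local Open Scope sesquilinear_scope.

(** Write B for the plane with Gram matrix (2, omega; omega^*, 2) and I_k for
    the lattice with Gram matrix the identity.

    The plane B is unimodular and represents no vector of norm 1.  So the
    projection to B of a vector of norm 1 is an integral vector of norm at most
    1, hence zero: in a lattice that represents I_2 and B, the two are
    orthogonal, and the lattice represents the quaternary lattice I_2 + B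
    ([contains_quaternary]).  It remains to see that I_2 + B represents each
    binary positive lattice l ([quaternary_universal]).

    The first step embeds l in a unimodular ternary lattice.  The lattice
    l + <det l> has determinant (det l)^2, which is the norm of an element of
    Z[omega].  As long as the determinant z z^* of a ternary lattice N is not 1,
    a prime pi divides z, and the reduction of N modulo pi has a radical vector v
    with H(v) divisible by pi pi^*; then N + Z[omega] v / pi is integral, and its
    determinant is the norm of z / pi ([glue], [ternary_step],
    [unimodular_overlattice]).  For pi of prime norm each radical vector works.
    For an inert prime p the determinant is divisible by p^2: if the radical is a
    line, it is spanned by a row v of the adjugate, for which H(v) is a multiple
    of the determinant; otherwise H / p is a hermitian form over the field with
    p^2 elements on the radical, and it has isotropic vectors
    ([isotropic_mod]).

    The second step shows that the unimodular ternary positive lattices are I_3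
    and B + I_1 ([ternary_unimodular]).  For N with a diagonal entry m, the
    inverse matrix of N is isometric to N and has a principal block of
    determinant m.  The Euclidean algorithm reduces this block to
    (mu, b; b^*, c) with mu <= c and 11 |b|^2 <= 9 mu^2, so 2 mu^2 <= 11 m.
    Either mu < m, and mu is a smaller diagonal entry of a lattice isometric to
    N, or m <= 5 and there are few cases, of which only m = 1 survives.  A vector
    of norm 1 splits off and leaves a unimodular plane, which is I_2 or B by the
    same reduction.

    Now B + I_1 is part of I_2 + B, but I_3 is not represented by it.  The last
    step uses that l has rank 2: if l = X X^* with X a 2 x 3 matrix, the three
    columns of X are linearly dependent modulo omega, that is, over the field
    with 3 elements.  So l lies in a sublattice of I_3 defined by one linear
    congruence modulo omega.  Such a sublattice is also contained in a
    neighbour of I_3, or of I_4 when the congruence involves only one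
    coordinate, and this neighbour is B + I_1 or B + I_2
    ([three_squares_to_quaternary]). *)

(** * The ring Z[omega] *)

Lemma conj_sqrt_neg11 : (sqrtC (- 11%:R))^* = - sqrtC (- 11%:R) :> algC.
Proof.
set s := sqrtC _; have s2 : s ^+ 2 = - 11%:R by rewrite sqrtCK.
have : (s^*) ^+ 2 == s ^+ 2 by rewrite -rmorphXn s2 rmorphN rmorph_nat.
rewrite eqf_sqr => /orP [/eqP sr|/eqP //].
have sR : s \is Num.real by apply/CrealP.
by have := real_exprn_even_ge0 sR (isT : ~~ odd 2); rewrite s2 oppr_ge0 lern0.
Qed.

Lemma omega_sqr : omega * omega = omega - 3%:R.
Proof.
rewrite /omega; set s := sqrtC _; have s2 : s * s = - 11%:R by rewrite -expr2 sqrtCK.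
have -> : (1 + s) / 2%:R * ((1 + s) / 2%:R) = (1 + 2%:R * s + s * s) / 4%:R by field.
by rewrite s2; field.
Qed.

Lemma conj_omega : omega^* = 1 - omega.
Proof.
rewrite /omega rmorphM rmorphD fmorphV /= rmorph1 rmorph_nat conj_sqrt_neg11.
by field.
Qed.

Lemma conjM (x y : algC) : (x * y)^* = x^* * y^*.
Proof. exact: rmorphM. Qed.

Lemma conjD (x y : algC) : (x + y)^* = x^* + y^*.
Proof. exact: rmorphD. Qed.

Lemma conjN (x : algC) : (- x)^* = - x^*.
Proof. exact: rmorphN. Qed.

Lemma conjV (x : algC) : (x^-1)^* = (x^*)^-1.
Proof. exact: fmorphV. Qed.

Lemma conj_nat (n : nat) : (n%:R)^* = n%:R :> algC.
Proof. exact: rmorph_nat. Qed.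

Lemma conj_int (n : int) : (n%:~R)^* = n%:~R :> algC.
Proof. exact: rmorph_int. Qed.

Lemma conj0 : 0^* = 0 :> algC.
Proof. exact: rmorph0. Qed.

Lemma conj1 : 1^* = 1 :> algC.
Proof. exact: rmorph1. Qed.

Definition conjE := (conjD, conjN, conjM, conjV, conj_int, conj_nat, conj0,
                     conj1, conj_omega, (@conjCK algC)).

Definition oelt (a b : int) : algC := a%:~R + b%:~R * omega.

(** This is the norm of [oelt a b], see [onormE]. *)
Definition onorm (a b : int) : int := a * a + a * b + 3 * (b * b).

Lemma oeltD a b c d : oelt a b + oelt c d = oelt (a + c) (b + d).
Proof. by rewrite /oelt; ring. Qed.

Lemma oeltN a b : - oelt a b = oelt (- a) (- b).
Proof. by rewrite /oelt; ring. Qed.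

Lemma oeltM a b c d :
  oelt a b * oelt c d = oelt (a * c - 3 * (b * d)) (a * d + b * c + b * d).
Proof.
rewrite /oelt; have w2 := omega_sqr; ring: w2.
Qed.

Lemma conj_oelt a b : (oelt a b)^* = oelt (a + b) (- b).
Proof. by rewrite /oelt !conjE; ring. Qed.

Lemma oelt_int a : a%:~R = oelt a 0.
Proof. by rewrite /oelt mul0r addr0. Qed.

Lemma onormE a b : oelt a b * (oelt a b)^* = (onorm a b)%:~R.
Proof. by rewrite conj_oelt oeltM oelt_int /onorm; congr oelt; ring. Qed.

Lemma omega_unreal a b : oelt a b = (oelt a b)^* -> b = 0.
Proof.
rewrite conj_oelt => /eqP; rewrite -subr_eq0 oeltN oeltD.
have -> : oelt (a - (a + b)) (b - - b) = b%:~R * sqrtC (- 11%:R).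
  by rewrite /oelt /omega; field.
by rewrite mulf_eq0 sqrtC_eq0 oppr_eq0 intr_eq0 pnatr_eq0 orbF => /eqP.
Qed.

Lemma oelt_inj a b c d : oelt a b = oelt c d -> a = c /\ b = d.
Proof.
move=> /eqP; rewrite -subr_eq0 oeltN oeltD => /eqP e.
have bd : b - d = 0 by apply: (@omega_unreal (a - c)); rewrite e rmorph0.
move/eqP: e; rewrite /oelt bd mul0r addr0 intr_eq0 subr_eq0 => /eqP.
by split=> //; apply/eqP; rewrite -subr_eq0 bd.
Qed.

Lemma inOP x : inO x <-> exists a b, x = oelt a b.
Proof.
split=> [[p ->]|[a [b ->]]]; last first.
  exists (a%:P + b *: 'X).
  by rewrite rmorphD /= map_polyC map_polyZ map_polyX hornerD hornerC hornerZ hornerX.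
elim/poly_ind: p => [|p c [a [b e]]].
  by exists 0, 0; rewrite rmorph0 horner0 -oelt_int.
rewrite rmorphD rmorphM /= map_polyX map_polyC hornerD hornerM hornerX hornerC /= e.
have -> : omega = oelt 0 1 by rewrite /oelt add0r mul1r.
by rewrite oelt_int oeltM oeltD; eexists; eexists; reflexivity.
Qed.

Lemma inO_oelt a b : inO (oelt a b).
Proof. by apply/inOP; exists a, b. Qed.

Lemma inO_int a : inO a%:~R.
Proof. by rewrite oelt_int; apply: inO_oelt. Qed.

Lemma inO_nat (n : nat) : inO n%:R.
Proof. exact: (inO_int n). Qed.

Lemma inO0 : inO 0. Proof. exact: (inO_nat 0). Qed.
Lemma inO1 : inO 1. Proof. exact: (inO_nat 1). Qed.

Lemma inO_omega : inO omega.
Proof. by apply/inOP; exists 0, 1; rewrite /oelt add0r mul1r. Qed.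

Lemma inOD x y : inO x -> inO y -> inO (x + y).
Proof.
move=> /inOP [a [b ->]] /inOP [c [d ->]]; rewrite oeltD; exact: inO_oelt.
Qed.

Lemma inON x : inO x -> inO (- x).
Proof. by move=> /inOP [a [b ->]]; rewrite oeltN; apply: inO_oelt. Qed.

Lemma inOB x y : inO x -> inO y -> inO (x - y).
Proof. by move=> hx hy; apply: inOD => //; apply: inON. Qed.

Lemma inOM x y : inO x -> inO y -> inO (x * y).
Proof.
move=> /inOP [a [b ->]] /inOP [c [d ->]]; rewrite oeltM; exact: inO_oelt.
Qed.

Lemma inO_conj x : inO x -> inO x^*.
Proof. by move=> /inOP [a [b ->]]; rewrite conj_oelt; apply: inO_oelt. Qed.

#[local] Hint Resolve inO0 inO1 inO_nat inO_int inO_omega inO_oelt : inO.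
#[local] Hint Resolve inOB inOD inON inOM inO_conj : inO.

Lemma inO_sum (I : Type) (r : seq I) (P : pred I) (F : I -> algC) :
  (forall i, P i -> inO (F i)) -> inO (\sum_(i <- r | P i) F i).
Proof. move=> h; apply: big_ind => //; [exact: inO0|exact: inOD]. Qed.

Lemma inO_prod (I : Type) (r : seq I) (P : pred I) (F : I -> algC) :
  (forall i, P i -> inO (F i)) -> inO (\prod_(i <- r | P i) F i).
Proof. move=> h; apply: big_ind => //; [exact: inO1|exact: inOM]. Qed.

Lemma inO_real x : inO x -> x^* = x -> exists k : int, x = k%:~R.
Proof.
move=> /inOP [a [b ->]] e; exists a.
by rewrite /oelt (omega_unreal (esym e)) mul0r addr0.
Qed.

Lemma inO_int_div (d : nat) (k : int) : (0 < d)%N ->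
  inO (k%:~R / d%:R) <-> (d %| k)%Z.
Proof.
move=> d0; have dC : d%:R != 0 :> algC by rewrite pnatr_eq0 -lt0n.
split=> [h|/dvdzP [q ->]]; last by rewrite intrM -pmulrn mulfK //; auto with inO.
have [|q e] := inO_real h; first by rewrite !conjE.
apply/dvdzP; exists q; apply/eqP; rewrite -(eqr_int algC) intrM -e -pmulrn.
by rewrite divfK.
Qed.

Lemma inO_oelt_div (d : nat) (a b : int) : (0 < d)%N ->
  inO (oelt a b / d%:R) <-> (d %| a)%Z /\ (d %| b)%Z.
Proof.
move=> d0; have dC : d%:R != 0 :> algC by rewrite pnatr_eq0 -lt0n.
split=> [/inOP [x [y e]]|[/dvdzP [x ->] /dvdzP [y ->]]].
  have : oelt a b = oelt (x * d) (y * d).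
    by rewrite -[LHS](divfK dC) e /oelt !intrM -!pmulrn; ring.
  by move/oelt_inj => [-> ->]; split; apply: dvdz_mull.
have -> : oelt (x * d) (y * d) / d%:R = oelt x y.
  by rewrite /oelt !intrM -!pmulrn; field.
exact: inO_oelt.
Qed.

(** * Euclidean division in Z[omega] *)

Lemma onorm_ge0 x y : 0 <= onorm x y.
Proof. rewrite /onorm; nia. Qed.

(** The three inequalities say that z = x + y omega is not closer to one of
    +-a, +-a omega, +-a omega^* than to 0, so z lies in the Voronoi cell of
    a Z[omega], a hexagon of squared circumradius 9 a^2 / 11.  With X = 2 x + y
    and Y = 11 y, the norm is (11 X^2 + Y^2) / 44, and the last two inequalities
    amount to |X| + |Y| <= 6 a. *)
Lemma voronoi_bound (a x y : int) : 0 < a ->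
  `|2 * x + y| <= a -> `|x + 6 * y| <= 3 * a -> `|x - 5 * y| <= 3 * a ->
  11 * onorm x y <= 9 * (a * a).
Proof.
rewrite /onorm => a0 h1 h2 h3.
set X := 2 * x + y in h1; set Y := 11 * y.
have e : 44 * (x * x + x * y + 3 * (y * y)) = 11 * (X * X) + Y * Y.
  by rewrite /X /Y; ring.
have h4 : `|X| + `|Y| <= 6 * a by rewrite /X /Y; lia.
have h5 : 0 <= (6 * a - `|X| - `|Y|) * (6 * a - `|X| + `|Y|).
  by apply: mulr_ge0; lia.
have h6 : 0 <= `|X| * (a - `|X|) by apply: mulr_ge0; lia.
have eX : X * X = `|X| * `|X| by nia.
have eY : Y * Y = `|Y| * `|Y| by nia.
by nia.
Qed.

(** Subtracting multiples of a, a omega and a omega^* decreases the norm until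
    the remainder is in the Voronoi cell.  The constant 9 / 11 is the best
    possible, and the classification of ternary lattices depends on it; the bound on
    2 x + y, the trace of the remainder, excludes some further cases there. *)
Lemma euclid (a : int) z : 0 < a -> inO z ->
  exists q x y, [/\ inO q, z - a%:~R * q = oelt x y,
    `|2 * x + y| <= a & 11 * onorm x y <= 9 * (a * a)].
Proof.
move=> a0 /inOP [x [y ->]]; have [n] := ubnP `|onorm x y|%N.
elim: n x y => // n IHn x y le_n.
have shift s t : onorm (x - a * s) (y - a * t) < onorm x y ->
    exists q x' y', [/\ inO q, oelt x y - a%:~R * q = oelt x' y',
      `|2 * x' + y'| <= a & 11 * onorm x' y' <= 9 * (a * a)].
  move=> lt_xy.
  have [|q [x' [y' [Oq e h1 h2]]]] := IHn (x - a * s) (y - a * t).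
    by have := onorm_ge0 (x - a * s) (y - a * t); lia.
  exists (q + oelt s t), x', y'; split; auto with inO.
  by rewrite -e /oelt; ring.
have [h1|h1] := leP `|2 * x + y| a; last first.
  have [h|h] := leP 0 (2 * x + y).
    by apply: (shift 1 0); rewrite /onorm; nia.
  by apply: (shift (- 1) 0); rewrite /onorm; nia.
have [h2|h2] := leP `|x + 6 * y| (3 * a); last first.
  have [h|h] := leP 0 (x + 6 * y).
    by apply: (shift 0 1); rewrite /onorm; nia.
  by apply: (shift 0 (- 1)); rewrite /onorm; nia.
have [h3|h3] := leP `|x - 5 * y| (3 * a); last first.
  have [h|h] := leP 0 (x - 5 * y).
    by apply: (shift 1 (- 1)); rewrite /onorm; nia.
  by apply: (shift (- 1) 1); rewrite /onorm; nia.
exists 0, x, y; split; auto with inO; first by rewrite mulr0 subr0.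
exact: voronoi_bound.
Qed.

Lemma norm_inO z : inO z -> exists k : nat, z * z^* = k%:R.
Proof.
move=> /inOP [a [b ->]]; exists `|onorm a b|%N; rewrite onormE.
by rewrite pmulrn gez0_abs // onorm_ge0.
Qed.

(** Fermat descent: if z has norm k p with 1 < k < p and r is the remainder of z
    modulo k, then z r^* / k is integral of norm k' p with k' = |r|^2 / k < k. *)
Lemma norm_descent (p k : nat) z : prime p -> (0 < k < p)%N -> inO z ->
  z * z^* = (k * p)%:R -> exists2 w, inO w & w * w^* = p%:R.
Proof.
move=> p_pr; have [n] := ubnP k.
elim: n k z => // n IHn k z le_kn /andP [k0 kp] Oz; rewrite natrM => zz.
have [k1|k1] := eqVneq k 1%N; first by exists z; rewrite // zz k1 mul1r.
have [|q [x [y [Oq e _ bound]]]] := @euclid k z _ Oz; first by lia.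
have kC : k%:R != 0 :> algC by rewrite pnatr_eq0 -lt0n.
have [s Os sk] : exists2 s, inO s & s * k%:R = z * (oelt x y)^*.
  exists (p%:R - z * q^*); first by auto with inO.
  by rewrite -e !conjE -pmulrn; ring: zz.
have [j ss] := norm_inO Os.
have eN : (j * k)%:Z = onorm x y * p%:Z.
  apply/eqP; rewrite -(eqr_int algC); apply/eqP/(mulIf kC).
  have -> : (j * k)%:~R * k%:R = (s * k%:R) * (s * k%:R)^* :> algC.
    by rewrite !conjE -!pmulrn natrM -ss; ring.
  rewrite sk (conjM z) conjCK intrM -onormE -pmulrn; ring: zz.
have p_dvd_j : (p %| j)%N.
  have : (p %| j * k)%N.
    by have := dvdz_mull (onorm x y) (dvdzz p%:Z); rewrite -eN dvdzE.
  rewrite Euclid_dvdM // => /orP [//|/dvdn_leq]; lia.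
case/dvdnP: p_dvd_j => j' ej.
have eN' : (j' * k)%:Z = onorm x y.
  have p0 : p%:Z != 0 by have := prime_gt0 p_pr; lia.
  by apply: (mulIf p0); rewrite -eN ej; lia.
have j'k : (j' < k)%N by nia.
have [j0|j0] := posnP j'; last first.
  by apply: (IHn j' s) => //; [lia|lia|rewrite ss ej].
(* the remainder vanishes, so k divides z and hence p *)
have r0 : oelt x y = 0.
  by have /eqP := onormE x y; rewrite -eN' j0 mulf_eq0 fmorph_eq0 orbb => /eqP.
have ez : z = k%:R * q by apply/eqP; rewrite -subr_eq0 pmulrn e r0.
have [i qq] := norm_inO Oq.
have : (k * (k * i))%N = (k * p)%N.
  apply/eqP; rewrite -(eqr_nat algC) !natrM -zz ez -qq conjM conj_nat.
  by apply/eqP; ring.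
move/eqP; rewrite eqn_pmul2l // => /eqP ep.
have : (k %| p)%N by rewrite -ep dvdn_mulr.
by case/primeP: p_pr => _ h /h; lia.
Qed.

(** * Primes of Z[omega] and their residue fields *)

(** For a prime p this says that p remains prime in Z[omega]: the norm is
    anisotropic modulo p, so that the residue ring is a field. *)
Definition inert (p : nat) : Prop :=
  forall z, inO z -> inO (z * z^* / p%:R) -> inO (z / p%:R).

Lemma prime_neq0 p : prime p -> p%:R != 0 :> algC.
Proof. by move=> p_pr; rewrite pnatr_eq0 -lt0n prime_gt0. Qed.

Lemma inert_or_norm p : prime p ->
  inert p \/ exists2 pi, inO pi & pi * pi^* = p%:R.
Proof.
move=> p_pr; have p0 := prime_neq0 p_pr.
have [|no_pi] := classic (exists2 pi, inO pi & pi * pi^* = p%:R); first by right.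
left=> z Oz Ozz; apply: NNPP => nOz; apply: no_pi.
have [|q [x [y [Oq e _ bound]]]] := @euclid p z _ Oz.
  by have := prime_gt0 p_pr; lia.
have /(inO_int_div _ (prime_gt0 p_pr)) /dvdzP [k ek] :
  inO ((onorm x y)%:~R / p%:R).
- rewrite -onormE -e !conjE -!pmulrn.
  have -> : (z - p%:R * q) * (z^* - p%:R * q^*) / p%:R
     = z * z^* / p%:R - q * z^* - z * q^* + p%:R * q * q^* by field.
  by do ?[apply: inOB|apply: inOD]; auto with inO.
have p_gt0 := prime_gt0 p_pr; have N0 := onorm_ge0 x y.
apply: (@norm_descent p `|k|%N (oelt x y)) => //; auto with inO.
- have k0 : onorm x y != 0.
    apply/eqP => N_0; apply: nOz.
    have /eqP := onormE x y; rewrite N_0 mulf_eq0 fmorph_eq0 orbb -e subr_eq0.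
    by move/eqP => ->; rewrite -pmulrn mulrAC divff // mul1r.
  nia.
by rewrite onormE ek natrM !pmulrn gez0_abs ?intrM //; nia.
Qed.

Lemma int_inverse (p : nat) (k : int) : prime p -> ~~ (p %| k)%Z ->
  exists u v : int, u * p + v * k = 1.
Proof.
move=> p_pr ndvd; have /coprimezP [[u v] /= e] : coprimez p k; last by exists u, v.
by rewrite coprimezE prime_coprime.
Qed.

(** Each square has at most two roots. *)
Lemma card_squares_Fp (p : nat) : prime p -> odd p ->
  (p < 2 * #|[set (x ^+ 2)%R | x : 'F_p]|)%N.
Proof.
move=> p_pr p_odd; set S := [set _ | _ in _].
suff : (p <= #|S| * 2)%N by move: p_odd; lia.
rewrite -{1}(card_Fp p_pr) -(sum1_card 'F_p) (partition_big (fun x : 'F_p => x ^+ 2) (mem S)) /=.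
  rewrite -sum_nat_const; apply: leq_sum => y _; rewrite sum1dep_card.
  have [x0 /eqP <-|none] := pickP (fun x : 'F_p => x ^+ 2 == y); last first.
    by rewrite eq_card0 // => x; rewrite inE none.
  apply: leq_trans (subset_leq_card (B := pred2 x0 (- x0)) _) _.
    by apply/subsetP=> x; rewrite !inE eqf_sqr.
  by rewrite card2; case: eqP.
by move=> x _; apply: imset_f.
Qed.

(** Up to a change of variables the norm form is u^2 + 11 v^2 / 4.  The sets of
    values of u^2 and of c - 11 v^2 / 4 modulo p both have more than p / 2
    elements, so they meet. *)
Lemma onorm_onto_mod (p : nat) (c : int) : prime p -> odd p -> p != 11%N ->
  exists x y, (p %| onorm x y - c)%Z.
Proof.
move=> p_pr p_odd p11; have pchar := pchar_Fp p_pr.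
have n2 : 2%:R != 0 :> 'F_p.
  by rewrite -(dvdn_pcharf pchar) dvdn_prime2 //; case: eqP p_odd => // ->.
have n11 : 11%:R != 0 :> 'F_p.
  by rewrite -(dvdn_pcharf pchar) dvdn_prime2.
set S := [set (x ^+ 2)%R | x : 'F_p].
have cardS : (p < 2 * #|S|)%N := card_squares_Fp p_pr p_odd.
pose f (a : 'F_p) := c%:~R - 11%:R / 4%:R * a.
have n4 : 4%:R != 0 :> 'F_p by rewrite (natrM _ 2 2) mulf_neq0.
have f_inj : injective f.
  move=> a b /addrI /oppr_inj; apply: mulfI; apply: mulf_neq0 => //.
  by rewrite invr_eq0.
have : ~~ [disjoint S & f @: S].
  apply/negP => dis; have := subset_leq_card (subsetT (S :|: f @: S)).
  rewrite cardsT card_Fp // cardsU (card_imset _ f_inj) disjoint_setI0 // cards0.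
  by move: cardS; lia.
rewrite -setI_eq0 => /set0Pn [y]; rewrite inE => /andP [/imsetP [u _ ->]].
case/imsetP => _ /imsetP [v _ ->] e.
have lift (w : 'F_p) : exists k : int, w = k%:~R.
  by exists (w : nat)%:Z; rewrite -pmulrn natr_Zp.
have [x ex] := lift (u - v / 2%:R); have [z ez] := lift v.
exists x, z; rewrite (dvdz_pcharf pchar) /onorm !(intrD, intrM, rmorphN) /= -ex -ez.
apply/eqP.
have -> : (u - v / 2%:R) * (u - v / 2%:R) + (u - v / 2%:R) * v + 3%:~R * (v * v)
   - c%:~R = u ^+ 2 - f (v ^+ 2) by rewrite /f; field; rewrite n2 n4.
by rewrite e subrr.
Qed.

(** A generator of a prime ideal above the prime p.  The second alternative
    covers the split and the ramified primes, whose residue field is the prime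
    field. *)
Definition prime_over (p : nat) (pi : algC) : Prop :=
  inert p /\ pi = p%:R \/ inO pi /\ pi * pi^* = p%:R.

Lemma prime_over_inO p pi : prime_over p pi -> inO pi.
Proof. by case=> [[_ ->]|[]] //; auto with inO. Qed.

Lemma prime_over_neq0 p pi : prime p -> prime_over p pi -> pi != 0.
Proof.
move=> p_pr [[_ ->]|[_ e]]; first exact: prime_neq0.
by apply: contraTneq (prime_neq0 p_pr) => pi0; rewrite -e pi0 mul0r eqxx.
Qed.

Lemma prime_over_dvd p pi : prime p -> prime_over p pi -> inO (p%:R / pi).
Proof.
move=> p_pr h; have pi0 := prime_over_neq0 p_pr h.
case: h => [[_ e]|[Opi <-]]; first by rewrite e divff -?e //; auto with inO.
by rewrite mulrAC divff // mul1r; auto with inO.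
Qed.

(** The residue ring of a prime is a field: if p is inert, z^* times an inverse
    of the norm is an inverse of z; otherwise every residue class contains an
    integer. *)
Lemma inverse_mod p pi z : prime p -> prime_over p pi -> inO z ->
  ~ inO (z / pi) -> exists2 w, inO w & inO ((w * z - 1) / pi).
Proof.
move=> p_pr hpi Oz nz; have pi0 := prime_over_neq0 p_pr hpi.
have Oppi := prime_over_dvd p_pr hpi; have Opi := prime_over_inO hpi.
have p0 := prime_neq0 p_pr.
case: hpi => [[p_in pE]|[_ N]].
  have [k kE] := norm_inO Oz.
  have ndvd : ~~ (p %| k%:Z)%Z.
    apply/negP => /(inO_int_div _ (prime_gt0 p_pr)); rewrite -pmulrn -kE => h.
    by apply: nz; rewrite pE; apply: p_in.
  have [u [v /(congr1 (fun i : int => i%:~R : algC))]] := int_inverse p_pr ndvd.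
  rewrite intrD !intrM mulr1z -!pmulrn -kE => e; exists (v%:~R * z^*); auto with inO.
  have -> : (v%:~R * z^* * z - 1) / pi = - u%:~R.
    by rewrite pE -[X in (_ - X) / _]e; field.
  by auto with inO.
case/inOP: Oz => a [b zE]; case/inOP: (Opi) => s [t piE].
have Npi : onorm s t = p.
  by apply/eqP; rewrite -(eqr_int algC) -onormE -piE N -pmulrn.
have ndvd : ~~ (p %| t)%Z.
  have p1 := prime_gt1 p_pr.
  apply/negP => /dvdzP [t' tE]; have : (p%:Z %| s * s)%Z.
    apply/dvdzP; exists (1 - s * t' - 3 * (t' * t)).
    by move: Npi; rewrite /onorm tE; nia.
  rewrite dvdzE abszM Euclid_dvdM // orbb -dvdzE => /dvdzP [s' sE].
  have pN : p%:Z * onorm s' t' = 1.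
    have pZ0 : p%:Z != 0 by lia.
    by apply: (mulfI pZ0); move: Npi; rewrite /onorm sE tE; nia.
  by have := dvdz_mulr (onorm s' t') (dvdzz p); rewrite pN dvdzE dvdn1; lia.
(* omega is congruent to an integer modulo pi, hence so is every z *)
have [u [v euv]] := int_inverse p_pr ndvd.
have /(congr1 (fun i : int => i%:~R : algC)) := euv.
rewrite intrD !intrM mulr1z -pmulrn -N => e.
have zk : z = (a - b * v * s)%:~R + pi * (b%:~R * (v%:~R + u%:~R * pi^* * omega)).
  rewrite zE /oelt intrB !intrM.
  have -> : b%:~R * omega = b%:~R * omega * (u%:~R * (pi * pi^*) + v%:~R * t%:~R).
    by rewrite e mulr1.
  have piE' : pi = s%:~R + t%:~R * omega by [].
  by ring: piE'.
set k := a - b * v * s in zk; set r := b%:~R * _ in zk.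
have Or : inO r by rewrite /r; auto 10 with inO.
have ndvdk : ~~ (p %| k)%Z.
  apply/negP => /(inO_int_div _ (prime_gt0 p_pr)) hk; apply: nz.
  have -> : z / pi = k%:~R / p%:R * (p%:R / pi) + r by rewrite zk; field; apply/andP.
  by auto with inO.
have [u' [v' /(congr1 (fun i : int => i%:~R : algC))]] := int_inverse p_pr ndvdk.
rewrite intrD !intrM mulr1z -pmulrn => e'.
exists v'%:~R; auto with inO.
have -> : (v'%:~R * z - 1) / pi = v'%:~R * r - u'%:~R * (p%:R / pi).
  by rewrite zk -[X in (_ - X) / _]e'; field.
by auto with inO.
Qed.

Lemma prime_over_prime p pi z : prime p -> prime_over p pi -> inO z ->
  inO (z * z^* / p%:R) -> inO (z / pi) \/ inO (z / pi^*).
Proof.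
move=> p_pr hpi Oz Ozz; have [|nz] := classic (inO (z / pi)); first by left.
right; have pi0 := prime_over_neq0 p_pr hpi; have Opi := prime_over_inO hpi.
have [w Ow Owz] := inverse_mod p_pr hpi Oz nz.
have pib0 : pi^* != 0 by rewrite fmorph_eq0.
case: hpi => [[p_in piE]|[_ N]]; first by case: nz; rewrite piE; apply: p_in.
rewrite -[z](conjCK z).
have -> : z^*^* / pi^* = (z^* / pi)^* by rewrite !conjE.
apply: inO_conj; have -> : z^* / pi
  = w * (z * z^* / p%:R) * pi^* - (w * z - 1) / pi * z^*.
  by rewrite -N; field; apply/andP.
by auto with inO.
Qed.

(** The norm of 2 omega - 1 is 11. *)
Lemma inert_neq11 p : inert p -> p != 11%N.
Proof.
move=> p_in; apply/eqP => p11; have := p_in (oelt (- 1) 2) (inO_oelt _ _).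
rewrite onormE p11 => h; have /h : inO ((onorm (- 1) 2)%:~R / 11%:R).
  by apply/inO_int_div.
by move/inO_oelt_div => [] //.
Qed.

(** A binary hermitian form (alpha, beta; beta^*, gamma) over the field with p^2
    elements has an isotropic vector.  After completing the square this
    amounts to finding an element of given norm modulo p. *)
Lemma isotropic_mod p (alpha gamma : int) beta :
  prime p -> inert p -> inO beta ->
  exists s t, [/\ inO s, inO t, t = 1 \/ (s = 1 /\ t = 0) &
    inO ((alpha%:~R * (s * s^*) + beta * (s * t^*) + beta^* * (s^* * t)
          + gamma%:~R * (t * t^*)) / p%:R)].
Proof.
move=> p_pr p_in Ob; have p0 := prime_neq0 p_pr; have pgt0 := prime_gt0 p_pr.
have [dvd_a|ndvd] := boolP (p %| alpha)%Z.
  exists 1, 0; split; auto with inO.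
  rewrite !conjE !(mulr1, mulr0, addr0); exact/inO_int_div.
have [u [v /(congr1 (fun i : int => i%:~R : algC))]] := int_inverse p_pr ndvd.
rewrite intrD !intrM mulr1z -pmulrn => e.
have [d dE] := norm_inO Ob.
have [x [y xy]] : exists x y, (p %| onorm x y - (d%:Z - alpha * gamma))%Z.
  have [p_odd|] := boolP (odd p); first exact: onorm_onto_mod p_pr p_odd (inert_neq11 p_in).
  move/(prime_oddPn p_pr) => ->; exists (d%:Z - alpha * gamma), 0.
  rewrite /onorm; set c := _ - alpha * gamma; have : (c * c + c * 0 + 3 * (0 * 0) - c) = c * (c - 1) by ring.
  have [k [-> ->|-> ->]] : exists k, c = 2 * k \/ c = 2 * k + 1.
    by exists (c %/ 2)%Z; lia.
    by apply/dvdzP; exists (k * (2 * k - 1)); ring.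
  by apply/dvdzP; exists ((2 * k + 1) * k); ring.
have h := (inO_int_div _ pgt0).2 xy.
exists (v%:~R * (oelt x y - beta^*)), 1; split; auto with inO.
set Y := oelt x y in h *; have YN : Y * Y^* = (onorm x y)%:~R by apply: onormE.
have OY : inO Y by apply: inO_oelt.
rewrite intrB intrB intrM -YN -pmulrn -dE in h.
clearbody Y.
set H := _ / _ in h.
have YYE : Y * Y^* = H * p%:R + beta * beta^* - alpha%:~R * gamma%:~R.
  by rewrite /H divfK //; ring.
have va : v%:~R * alpha%:~R = 1 - u%:~R * p%:R :> algC by rewrite -[X in X - _]e; ring.
clearbody H.
(* v inverts alpha modulo p: completing the square, alpha times the value is
   congruent to the norm of Y minus the discriminant *)
have -> : (alpha%:~R * (v%:~R * (Y - beta^*) * (v%:~R * (Y - beta^*))^*)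
    + beta * (v%:~R * (Y - beta^*) * 1^*)
    + beta^* * ((v%:~R * (Y - beta^*))^* * 1) + gamma%:~R * (1 * 1^*)) / p%:R
  = v%:~R * H + u%:~R * gamma%:~R
    - u%:~R * v%:~R * ((Y - beta^*) * (Y^* - beta)).
  apply: (canLR (mulfK p0)); rewrite !conjE; apply/eqP; rewrite -subr_eq0.
  apply/eqP; set Q := (Y - beta^*) * (Y^* - beta).
  transitivity (v%:~R * (Y * Y^* - (H * p%:R + beta * beta^* - alpha%:~R * gamma%:~R))
    + (v%:~R * Q - gamma%:~R) * (v%:~R * alpha%:~R - (1 - u%:~R * p%:R))).
    by rewrite /Q; ring.
  by rewrite YYE va !subrr; ring.
by apply: inOB; auto 10 with inO.
Qed.

(** * Integral matrices and representations *)

Lemma ctE m n (A : 'M[algC]_(m, n)) i j : (A ^t*) i j = (A j i)^*.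
Proof. by rewrite !mxE. Qed.

Lemma ctM m n k (A : 'M[algC]_(m, n)) (B : 'M[algC]_(n, k)) :
  (A *m B) ^t* = B ^t* *m A ^t*.
Proof. by rewrite trmx_mul map_mxM. Qed.

Lemma ct1mx n : (1%:M : 'M[algC]_n) ^t* = 1%:M.
Proof. by rewrite trmx1 map_mx1. Qed.

Lemma det_ct n (A : 'M[algC]_n) : \det (A ^t*) = (\det A)^*.
Proof. by rewrite det_map_mx det_tr. Qed.

Lemma over_O_mul m n k (A : 'M[algC]_(m, n)) (B : 'M[algC]_(n, k)) :
  mx_over_O A -> mx_over_O B -> mx_over_O (A *m B).
Proof. by move=> hA hB i j; rewrite mxE; apply: inO_sum => l _; apply: inOM. Qed.

Lemma over_O_ct m n (A : 'M[algC]_(m, n)) : mx_over_O A -> mx_over_O (A ^t*).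
Proof. by move=> hA i j; rewrite ctE; apply: inO_conj. Qed.

Lemma over_O_1 n : mx_over_O (1%:M : 'M[algC]_n).
Proof. by move=> i j; rewrite mxE; apply: inO_nat. Qed.

Lemma inO_det n (A : 'M[algC]_n) : mx_over_O A -> inO (\det A).
Proof.
move=> hA; apply: inO_sum => s _; apply: inOM; last exact: inO_prod.
by rewrite -signr_odd; case: odd; rewrite ?expr0 ?expr1; auto with inO.
Qed.

Lemma over_O_adjugate n (A : 'M[algC]_n) : mx_over_O A -> mx_over_O (\adj A).
Proof.
move=> hA i j; rewrite mxE; apply: inOM.
  by rewrite -signr_odd; case: odd; rewrite ?expr0 ?expr1; auto with inO.
by apply: inO_det => k l; rewrite !mxE.
Qed.

Lemma over_O_block m1 m2 n1 n2 (A : 'M[algC]_(m1, n1)) (B : 'M[algC]_(m1, n2))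
    (C : 'M[algC]_(m2, n1)) (D : 'M[algC]_(m2, n2)) :
  mx_over_O A -> mx_over_O B -> mx_over_O C -> mx_over_O D ->
  mx_over_O (block_mx A B C D).
Proof.
move=> hA hB hC hD i j.
by rewrite mxE; case: splitP => k _; rewrite mxE; case: splitP => l _.
Qed.

Lemma over_O_row m n1 n2 (A : 'M[algC]_(m, n1)) (B : 'M[algC]_(m, n2)) :
  mx_over_O A -> mx_over_O B -> mx_over_O (row_mx A B).
Proof. by move=> hA hB i j; rewrite mxE; case: splitP. Qed.

Lemma over_O_col m1 m2 n (A : 'M[algC]_(m1, n)) (B : 'M[algC]_(m2, n)) :
  mx_over_O A -> mx_over_O B -> mx_over_O (col_mx A B).
Proof. by move=> hA hB i j; rewrite mxE; case: splitP. Qed.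

Lemma over_O_0 m n : mx_over_O (0 : 'M[algC]_(m, n)).
Proof. by move=> i j; rewrite mxE; apply: inO0. Qed.

Lemma represents_refl n (L : 'M[algC]_n) : represents L L.
Proof.
by exists 1%:M; split; [exact: over_O_1|rewrite ct1mx mulmx1 mul1mx].
Qed.

Lemma represents_trans n m k (L : 'M[algC]_n) (M : 'M[algC]_m) (N : 'M[algC]_k) :
  represents L M -> represents M N -> represents L N.
Proof.
move=> [X [hX ->]] [Y [hY ->]]; exists (Y *m X); split; first exact: over_O_mul.
by rewrite ctM !mulmxA.
Qed.

Lemma herm_entry n (N : 'M[algC]_n) i j : N = N ^t* -> N i j = (N j i)^*.
Proof. by move=> e; rewrite {1}e ctE. Qed.

Lemma hermitian_congr m n (X : 'M[algC]_(m, n)) (N : 'M[algC]_n) :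
  N = N ^t* -> X *m N *m X ^t* = (X *m N *m X ^t*) ^t*.
Proof. by move=> e; rewrite !ctM trmxCK -e mulmxA. Qed.

(** The scalar c is a common denominator of Y: positivity on integral vectors
    gives positivity on the vectors x Y, after multiplication by c. *)
Lemma positive_congr n (N Y : 'M[algC]_n) (c : algC) :
  positive_lattice N -> c != 0 -> mx_over_O (c *: Y) -> Y \in unitmx ->
  mx_over_O (Y *m N *m Y ^t*) -> positive_lattice (Y *m N *m Y ^t*).
Proof.
move=> [[ON hN] posN] c0 OY uY OYN; split.
  by split=> //; apply: hermitian_congr.
move=> x Ox x0; have cY0 : x *m (c *: Y) != 0.
  rewrite -scalemxAr scaler_eq0 negb_or c0.
  by apply: contraNneq x0 => /(congr1 (mulmx^~ (invmx Y))) /eqP; rewrite mulmxK // mul0mx.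
have := posN _ (over_O_mul Ox OY) cY0; rewrite /herm_form.
have -> : x *m (c *: Y) *m N *m (x *m (c *: Y)) ^t*
  = (c * c^*) *: (x *m (Y *m N *m Y ^t*) *m x ^t*).
  rewrite -!scalemxAr linearZ /= map_mxZ -!scalemxAl -scalemxAr scalerA ctM.
  by rewrite !mulmxA.
by rewrite mxE pmulr_rgt0 // mul_conjC_gt0.
Qed.

Lemma herm_delta n (N : 'M[algC]_n) i : herm_form N (delta_mx 0 i) (delta_mx 0 i) = N i i.
Proof.
rewrite /herm_form -rowE trmx_delta map_delta_mx.
by rewrite -colE !mxE.
Qed.

Lemma positive_diag n (N : 'M[algC]_n) i : positive_lattice N ->
  exists2 k : nat, (0 < k)%N & N i i = k%:R.
Proof.
move=> [[ON hN] posN]; have [k kE] := inO_real (ON i i) (esym (herm_entry i i hN)).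
have : 0 < N i i.
  rewrite -herm_delta; apply: posN.
    by move=> r s; rewrite mxE; apply: inO_nat.
  by apply/eqP => /matrixP /(_ 0 i); rewrite !mxE !eqxx => /eqP; rewrite oner_eq0.
rewrite kE ltr0z => k0; exists `|k|%N; first by lia.
by rewrite pmulrn gez0_abs // ltW.
Qed.

(** * Adjoining a fraction to a lattice *)

Lemma hermDl n (N : 'M[algC]_n) x y z :
  herm_form N (x + y) z = herm_form N x z + herm_form N y z.
Proof. by rewrite /herm_form !mulmxDl mxE. Qed.

Lemma hermZl n (N : 'M[algC]_n) c x z : herm_form N (c *: x) z = c * herm_form N x z.
Proof. by rewrite /herm_form -!scalemxAl mxE. Qed.

Lemma herm_sym n (N : 'M[algC]_n) x y : N = N ^t* ->
  herm_form N x y = (herm_form N y x)^*.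
Proof.
move=> e; rewrite /herm_form -ctE !ctM trmxCK -e mulmxA //.
Qed.

Lemma hermDr n (N : 'M[algC]_n) x y z : N = N ^t* ->
  herm_form N z (x + y) = herm_form N z x + herm_form N z y.
Proof. by move=> e; rewrite herm_sym // hermDl conjD -!herm_sym. Qed.

Lemma hermZr n (N : 'M[algC]_n) c x z : N = N ^t* ->
  herm_form N z (c *: x) = c^* * herm_form N z x.
Proof. by move=> e; rewrite herm_sym // hermZl conjM -herm_sym. Qed.

Lemma herm_deltar n (N : 'M[algC]_n) x j : herm_form N x (delta_mx 0 j) = (x *m N) 0 j.
Proof. by rewrite /herm_form trmx_delta map_delta_mx -colE mxE. Qed.

Lemma congr_entry m n (Y : 'M[algC]_(m, n)) (N : 'M[algC]_n) k l :
  (Y *m N *m Y ^t*) k l = herm_form N (row k Y) (row l Y).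
Proof.
rewrite /herm_form -row_mul !mxE; apply: eq_bigr => j _.
by rewrite !mxE; congr (_ * _); apply: eq_bigr => h _; rewrite !mxE.
Qed.

(** The lattice spanned by N and v / pi.  As the coordinate i of v is 1, the
    vector v / pi can replace the i-th basis vector; the rows of Y are this new
    basis, and X expresses the old basis in it. *)
Lemma glue_normalized n (N : 'M[algC]_n) p pi (v : 'rV[algC]_n) i :
  prime p -> prime_over p pi -> positive_lattice N -> mx_over_O v ->
  (forall j, inO ((v *m N) 0 j / pi)) -> v 0 i = 1 ->
  inO (herm_form N v v / (pi * pi^*)) ->
  exists N' : 'M[algC]_n, [/\ positive_lattice N', represents N' N &
                       \det N = pi * pi^* * \det N'].
Proof.
move=> p_pr hpi posN Ov OvN vi Ovv; have pi0 := prime_over_neq0 p_pr hpi.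
have Opi := prime_over_inO hpi; have [[ON hN] _] := posN.
pose e : 'rV[algC]_n := delta_mx 0 i.
pose a := pi *: e - v; pose b := pi^-1 *: v - e.
pose X : 'M[algC]_n := 1%:M + e^T *m a; pose Y : 'M[algC]_n := 1%:M + e^T *m b.
have eE j : e 0 j = (j == i)%:R by rewrite mxE eqxx.
have eTE m (c : 'rV[algC]_m) k l : (e^T *m c) k l = (k == i)%:R * c 0 l.
  by rewrite mxE big_ord1 mxE eE.
have XY : X *m Y = 1%:M.
  have ae : a *m e^T = (pi - 1)%:M.
    rewrite /e trmx_delta -colE; apply/matrixP => r s.
    by rewrite !ord1 !mxE !eqxx mulr1 vi mulr1n.
  rewrite mulmxDl mul1mx mulmxDr mulmx1 -mulmxA (mulmxA a) ae mul_scalar_mx.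
  rewrite -addrA -mulmxDr -mulmxDr addrA [b + _]addrC -addrA.
  have -> : a + (b + (pi - 1) *: b) = 0.
    by apply/rowP => j; rewrite !mxE; field.
  by rewrite mulmx0 addr0.
have uY : Y \in unitmx by have [] := mulmx1_unit XY.
have rowY k : row k Y = if k == i then pi^-1 *: v else delta_mx 0 k.
  rewrite /Y; apply/rowP => j; rewrite !mxE big_ord1 !mxE eqxx /=.
  by have [->|_] := eqVneq k i; rewrite !mxE /= ?(eqxx, mulr1n, eq_sym j); ring.
have detY : \det Y = pi^-1.
  rewrite (expand_det_row _ i).
  have -> : \sum_j Y i j * cofactor Y i j = (Y *m \adj 1%:M) i i.
    rewrite mxE; apply: eq_bigr => j _; congr (_ * _); rewrite mxE /cofactor.
    congr (_ * \det _); apply/matrixP => r s; rewrite !mxE big_ord1 !mxE.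
    by rewrite [_ == i]eq_sym (negbTE (neq_lift _ _)) andbF mul0r addr0.
  rewrite adj1 mulmx1; have := congr1 (fun M : 'rV[algC]_n => M 0 i) (rowY i).
  by rewrite eqxx !mxE vi mulr1.
have OYNY : mx_over_O (Y *m N *m Y ^t*).
  have hYN := hermitian_congr Y hN.
  have row_i l : l != i -> inO ((Y *m N *m Y ^t*) i l).
    move=> li; rewrite congr_entry !rowY eqxx (negbTE li) hermZl herm_deltar mulrC.
    exact: OvN.
  move=> k l; have [->|ki] := eqVneq k i; have [->|li] := eqVneq l i.
  - rewrite congr_entry !rowY eqxx hermZl hermZr // mulrA mulrC conjV -invfM.
    exact: Ovv.
  - exact: row_i.
  - by rewrite hYN ctE; apply/inO_conj/row_i.
  - by rewrite congr_entry !rowY (negbTE ki) (negbTE li) herm_deltar -rowE mxE.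
exists (Y *m N *m Y ^t*); split.
- apply: (positive_congr posN pi0) => // k l.
  have := congr1 (fun M : 'rV[algC]_n => pi * M 0 l) (rowY k); rewrite !mxE => ->.
  by case: ifP => _; rewrite mxE ?mulVKf //; auto with inO.
- exists X; split.
    move=> k l; rewrite mxE eTE !mxE.
    by apply: inOD; last apply: inOM; last apply: inOB; auto with inO.
  by rewrite !mulmxA XY mul1mx -mulmxA -ctM XY ct1mx mulmx1.
rewrite !det_mulmx det_ct detY conjV; field.
by rewrite fmorph_eq0 pi0.
Qed.

(** If only the residue of the coordinate i is nonzero, multiplying v by an
    inverse and adding a multiple of pi times a basis vector reduces to
    the case of the coordinate 1. *)
Lemma glue n (N : 'M[algC]_n) p pi (v : 'rV[algC]_n) i :
  prime p -> prime_over p pi -> positive_lattice N -> mx_over_O v ->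
  (forall j, inO ((v *m N) 0 j / pi)) -> ~ inO (v 0 i / pi) ->
  inO (herm_form N v v / (pi * pi^*)) ->
  exists N' : 'M[algC]_n, [/\ positive_lattice N', represents N' N &
                       \det N = pi * pi^* * \det N'].
Proof.
move=> p_pr hpi posN Ov OvN nvi Ovv; have pi0 := prime_over_neq0 p_pr hpi.
have Opi := prime_over_inO hpi; have [[ON hN] _] := posN.
have [w Ow Or] := inverse_mod p_pr hpi (Ov 0 i) nvi.
set r := (_ / pi) in Or; have wv : w * v 0 i - 1 = pi * r.
  by rewrite /r [pi * _]mulrC divfK.
pose v' := w *: v + (- (pi * r)) *: delta_mx 0 i.
have v'N j : (v' *m N) 0 j = w * (v *m N) 0 j - pi * r * N i j.
  by rewrite mulmxDl -!scalemxAl -rowE !mxE mulNr.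
have Ov'N j : inO ((v' *m N) 0 j / pi).
  have -> : (v' *m N) 0 j / pi = w * ((v *m N) 0 j / pi) - r * N i j.
    by rewrite v'N; field.
  by auto with inO.
apply: (@glue_normalized _ _ p pi v' i) => //.
- move=> k j; rewrite !mxE; apply: inOD; auto with inO.
- by rewrite !mxE !eqxx mulr1 -wv; ring.
have hvv' : herm_form N v v' = w^* * herm_form N v v - (pi * r)^* * (v *m N) 0 i.
  by rewrite /v' hermDr // !hermZr // herm_deltar conjN mulNr.
have -> : herm_form N v' v' / (pi * pi^*)
  = w * w^* * (herm_form N v v / (pi * pi^*))
    - w * r^* * ((v *m N) 0 i / pi) - r * ((v' *m N) 0 i / pi)^*.
  rewrite {1}/v' hermDl !hermZl [herm_form N (delta_mx _ _) _]herm_sym //.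
  rewrite herm_deltar hvv' (conjM pi) conjM conjV; field.
  by rewrite fmorph_eq0 pi0.
by apply: inOB; auto with inO.
Qed.

(** * Unimodular overlattices of ternary lattices *)

Lemma det2E (A : 'M[algC]_2) : \det A = A 0 0 * A 1 1 - A 0 1 * A 1 0.
Proof.
rewrite (expand_det_row _ 0) !big_ord_recl big_ord0 addr0 /cofactor !det_mx11 !mxE /=.
have -> : lift 0 0 = 1 :> 'I_2 by apply: val_inj.
have -> : lift 1 0 = 0 :> 'I_2 by apply: val_inj.
by rewrite /= expr0 expr1; ring.
Qed.

Lemma two_of_three (i k : 'I_3) : i != k ->
  exists h : 'I_3, (i = lift h (0 : 'I_2) /\ k = lift h (1 : 'I_2)) \/
                   (i = lift h (1 : 'I_2) /\ k = lift h (0 : 'I_2)).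
Proof.
case: i k => [[|[|[|//]]] hi] [[|[|[|//]]] hk] // _;
  first [ by exists 0; left; split; apply: val_inj
        | by exists 0; right; split; apply: val_inj
        | by exists 1; left; split; apply: val_inj
        | by exists 1; right; split; apply: val_inj
        | by exists 2%:R; left; split; apply: val_inj
        | by exists 2%:R; right; split; apply: val_inj ].
Qed.

(** The 2 x 2 minors of a matrix of order 3 are, up to sign and apart from the
    trivial ones, the entries of the adjugate. *)
Lemma adj3_minors (N : 'M[algC]_3) c : (forall i j, inO (\adj N i j / c)) ->
  forall i k j l, inO ((N i j * N k l - N k j * N i l) / c).
Proof.
move=> adjO i k j l.
have [<-|/two_of_three [h hh]] := eqVneq i k; first by rewrite subrr mul0r; apply: inO0.
have [<-|/two_of_three [g gg]] := eqVneq j l.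
  by rewrite [N k j * _]mulrC subrr mul0r; apply: inO0.
have : inO ((-1) ^+ (h + g) * (\adj N g h / c)).
  apply: inOM => //; rewrite -signr_odd; case: odd; rewrite ?expr0 ?expr1; auto with inO.
rewrite mxE mulrA mulrA -exprD addnn -signr_odd odd_double expr0 mul1r det2E !mxE => Om.
have Om' := inON Om.
case: hh gg => [[-> ->]|[-> ->]] [[-> ->]|[-> ->]]; [move: Om|move: Om'|move: Om'|move: Om].
all: by congr inO; rewrite -?mulNr; congr (_ / c); ring.
Qed.

Lemma prime_over_conj p pi : prime_over p pi -> prime_over p pi^*.
Proof.
case=> [[p_in ->]|[Opi N]]; first by left; rewrite conj_nat.
by right; split; [auto with inO|rewrite conjCK mulrC].
Qed.

Lemma herm_real n (N : 'M[algC]_n) v : N = N ^t* -> mx_over_O N -> mx_over_O v ->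
  exists k : int, herm_form N v v = k%:~R.
Proof.
move=> hN ON Ov; apply: inO_real; last by rewrite -herm_sym.
by rewrite /herm_form; do ?apply: over_O_mul => //; apply: over_O_ct.
Qed.

Lemma herm_inO_div n (N : 'M[algC]_n) u v c : mx_over_O v ->
  (forall j, inO ((u *m N) 0 j / c)) -> inO (herm_form N u v / c).
Proof.
move=> Ov OuN; rewrite /herm_form mxE mulr_suml; apply: inO_sum => j _.
by rewrite ctE mulrAC; apply: inOM => //; apply: inO_conj.
Qed.

(** A rational integer divisible by a prime of norm p is divisible by p, and
    H(v) is such an integer. *)
Lemma norm_radical n (N : 'M[algC]_n) p pi v :
  prime p -> inO pi -> pi * pi^* = p%:R -> N = N ^t* -> mx_over_O N ->
  mx_over_O v -> (forall j, inO ((v *m N) 0 j / pi)) ->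
  inO (herm_form N v v / (pi * pi^*)).
Proof.
move=> p_pr Opi Npi hN ON Ov OvN; have [k kE] := herm_real hN ON Ov.
have p_gt0 := prime_gt0 p_pr.
have Ok : inO (k%:~R / pi) by rewrite -kE; apply: herm_inO_div.
have : inO ((k * k)%:~R / p%:R).
  rewrite intrM -Npi invfM mulrACA.
  by apply: inOM => //; have := inO_conj Ok; rewrite conjM conjV conj_int.
move/(inO_int_div _ p_gt0); rewrite dvdzE abszM Euclid_dvdM // orbb -dvdzE => dvd.
by rewrite kE Npi; apply/inO_int_div.
Qed.

(** Since adj(N) N = det(N), the rows of the adjugate are radical vectors modulo
    each divisor of the determinant. *)
Lemma adj_radical n (N : 'M[algC]_n) i : N = N ^t* ->
  (forall j, (row i (\adj N) *m N) 0 j = \det N * (i == j)%:R) /\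
  herm_form N (row i (\adj N)) (row i (\adj N)) = \det N * (\adj N i i)^*.
Proof.
move=> hN; have rE : row i (\adj N) *m N = \det N *: delta_mx 0 i.
  rewrite -row_mul mul_adj_mx; apply/rowP => j.
  by rewrite !mxE eqxx /= mulr_natr eq_sym.
split=> [j|]; first by rewrite rE !mxE eqxx eq_sym.
by rewrite /herm_form rE -scalemxAl -rowE !mxE.
Qed.

(** If the radical modulo an inert prime p contains two independent vectors r and
    r', then H / p is a hermitian form modulo p on their span, and an isotropic
    vector of it satisfies the divisibility by p^2 required in [glue].  The
    conditions on the coordinates j and k express the independence. *)
Lemma glue_inert n (N : 'M[algC]_n) p (r r' : 'rV[algC]_n) j k :
  prime p -> inert p -> positive_lattice N -> mx_over_O r -> mx_over_O r' ->
  (forall l, inO ((r *m N) 0 l / p%:R)) -> (forall l, inO ((r' *m N) 0 l / p%:R)) ->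
  ~ inO (r 0 j / p%:R) -> r 0 k = 0 -> ~ inO (r' 0 k / p%:R) ->
  exists N' : 'M[algC]_n, [/\ positive_lattice N', represents N' N &
                       \det N = p%:R * p%:R^* * \det N'].
Proof.
move=> p_pr p_in posN Or Or' OrN Or'N nrj rk nr'k.
have [[ON hN] _] := posN; have p0 := prime_neq0 p_pr; have p_gt0 := prime_gt0 p_pr.
have hp : prime_over p p%:R by left.
have diag v : mx_over_O v -> (forall l, inO ((v *m N) 0 l / p%:R)) ->
    exists k : int, herm_form N v v = p%:R * k%:~R.
  move=> Ov OvN; have [h hE] := herm_real hN ON Ov.
  have := herm_inO_div Ov OvN; rewrite hE => /(inO_int_div _ p_gt0) /dvdzP [q ->].
  by exists q; rewrite intrM mulrC.
have [alpha alphaE] := diag _ Or OrN; have [gamma gammaE] := diag _ Or' Or'N.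
pose beta := herm_form N r r' / p%:R; have Obeta : inO beta by apply: herm_inO_div.
have [s [t [Os Ot st0 Oiso]]] := isotropic_mod alpha gamma p_pr p_in Obeta.
pose v := s *: r + t *: r'.
have Ov : mx_over_O v by move=> i l; rewrite !mxE; auto with inO.
have OvN l : inO ((v *m N) 0 l / p%:R).
  have -> : (v *m N) 0 l / p%:R
    = s * ((r *m N) 0 l / p%:R) + t * ((r' *m N) 0 l / p%:R).
    rewrite mulmxDl -!scalemxAl; move: (r *m N) (r' *m N) => x y.
    by rewrite !mxE; field.
  by auto with inO.
have Ovv : inO (herm_form N v v / (p%:R * p%:R^*)).
  congr inO: Oiso; rewrite /v hermDl !hermDr // !(hermZl, hermZr) //.
  rewrite alphaE gammaE [herm_form N r' r]herm_sym //.
  have -> : herm_form N r r' = p%:R * beta by rewrite /beta mulrC divfK.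
  by rewrite (conjM p%:R) conj_nat; field.
case: st0 => [t1|[s1 t0]].
  by apply: (glue (i := k) p_pr hp posN Ov OvN _ Ovv); rewrite !mxE rk mulr0 add0r t1 mul1r.
by apply: (glue (i := j) p_pr hp posN Ov OvN _ Ovv); rewrite !mxE s1 t0 mul0r addr0 mul1r.
Qed.

Lemma not_all_inO m n (A : 'M[algC]_(m, n)) c : ~ (forall i j, inO (A i j / c)) ->
  exists i j, ~ inO (A i j / c).
Proof.
move=> /not_all_ex_not [i /not_all_ex_not [j nij]]; by exists i, j.
Qed.

(** The radical vector is a row of the adjugate of N if this matrix is nonzero
    modulo pi.  Otherwise N has rank at most 1 modulo pi, and combinations of two
    rows of N vanish modulo pi. *)
Lemma ternary_step (N : 'M[algC]_3) p pi z : prime p -> prime_over p pi ->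
  positive_lattice N -> inO z -> inO (z / pi) -> \det N = z * z^* ->
  exists N' : 'M[algC]_3, [/\ positive_lattice N', represents N' N &
                       \det N = pi * pi^* * \det N'].
Proof.
move=> p_pr hpi posN Oz Ozpi detN; have [[ON hN] _] := posN.
have pi0 := prime_over_neq0 p_pr hpi; have Opi := prime_over_inO hpi.
have p0 := prime_neq0 p_pr; have p_gt0 := prime_gt0 p_pr.
have pib0 : pi^* != 0 by rewrite fmorph_eq0.
have OdetN : inO (\det N / (pi * pi^*)).
  rewrite detN invfM mulrACA; apply: inOM => //.
  by have := inO_conj Ozpi; rewrite conjM conjV.
have Oadj := over_O_adjugate ON.
have [adj0|/not_all_inO [i [j nij]]] := classic (forall i j, inO (\adj N i j / pi)); last first.
  have [vN vv] := adj_radical i hN.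
  apply: (@glue _ N p pi (row i (\adj N)) j) => //.
  - by move=> k l; rewrite mxE.
  - move=> l; rewrite vN mulrAC; apply: inOM; auto with inO.
    have -> : \det N / pi = \det N / (pi * pi^*) * pi^* by field; apply/andP.
    by auto with inO.
  - by rewrite mxE.
  - by rewrite vv mulrAC; auto with inO.
have minors := adj3_minors adj0.
(* the product of v i j k with N consists of minors of the rows i and k *)
pose v (i j k : 'I_3) : 'rV[algC]_3 := N i j *: delta_mx 0 k - N k j *: delta_mx 0 i.
have Ov i j k : mx_over_O (v i j k) by move=> r s; rewrite !mxE; auto with inO.
have vN i j k l : inO ((v i j k *m N) 0 l / pi).
  rewrite /v mulmxBl -!scalemxAl -!rowE !mxE; exact: minors.
have delta0N k : mx_over_O (delta_mx 0 k : 'rV_3).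
  by move=> r s; rewrite mxE; apply: inO_nat.
have vE i j k l : v i j k 0 l = N i j * (l == k)%:R - N k j * (l == i)%:R.
  by rewrite !mxE eqxx.
have n1 : ~ inO (1 / pi).
  have np : ~ inO (1%:~R / p%:R).
    by move/(inO_int_div _ p_gt0); rewrite dvdzE dvdn1; have := prime_gt1 p_pr; lia.
  move=> O1; apply: np; case: (hpi) => [[_ <-] //|[_ <-]].
  have := inO_conj O1; rewrite conjM conjV conj1 mulr1z => O1'.
  have -> : 1 / (pi * pi^*) = 1 / pi * (1 / pi^*) by field; apply/andP.
  by auto with inO.
have [N0|/not_all_inO [i [j nij]]] := classic (forall i j, inO (N i j / pi)).
  case: (hpi) => [[p_in piE]|[_ Npi]].
    move: N0 n1; rewrite piE => N0 n1.
    apply: (@glue_inert _ N p (delta_mx 0 0) (delta_mx 0 1) 0 1) => //.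
    + by move=> l; rewrite -rowE mxE.
    + by move=> l; rewrite -rowE mxE.
    + by rewrite mxE.
    + by rewrite mxE.
    + by rewrite mxE.
  have eN l : inO (((delta_mx 0 0 : 'rV_3) *m N) 0 l / pi) by rewrite -rowE mxE.
  apply: (@glue _ N p pi (delta_mx 0 0) 0) => //; first by rewrite mxE.
  exact: norm_radical p_pr _ _ _ _ _ _.
case: (hpi) => [[p_in piE]|[_ Npi]].
  have [k [l [ki li kl]]] : exists k l : 'I_3, [/\ k != i, l != i & k != l].
    exists (i + 1), (i + 2%:R).
    by case: {+}i => [[|[|[|//]]] ?].
  (* if N i i = 0 mod p, the minor of the rows and columns i, j shows that p
     divides the norm of N i j *)
  have nii : ~ inO (N i i / pi).
    move=> Oii; apply: nij; move: Oii (minors i j i j).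
    rewrite piE => Oii Om; apply: p_in => //.
    have -> : N i j * (N i j)^* / p%:R = N i i / p%:R * N j j
       - (N i i * N j j - N j i * N i j) / p%:R.
      by rewrite -herm_entry //; field.
    by auto with inO.
  move: nii vN; rewrite piE => nii vN.
  apply: (@glue_inert _ N p (v i i k) (v i i l) k l) => //.
  - by rewrite vE eqxx (negbTE ki) mulr1 mulr0 subr0.
  - by rewrite vE eq_sym (negbTE kl) (negbTE li) !mulr0 subr0.
  - by rewrite vE eqxx (negbTE li) mulr1 mulr0 subr0.
have [k ki] : exists k : 'I_3, k != i.
  by exists (i + 1); case: {+}i => [[|[|[|//]]] ?].
apply: (@glue _ N p pi (v i j k) k) => //.
  by rewrite vE eqxx (negbTE ki) mulr1 mulr0 subr0.
exact: norm_radical p_pr _ _ _ _ _ _.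
Qed.

Lemma norm_gt0 z : inO z -> z != 0 -> exists2 k : nat, (0 < k)%N & z * z^* = k%:R.
Proof.
move=> Oz z0; have [k kE] := norm_inO Oz; exists k => //.
by rewrite -(ltr0n algC) -kE mul_conjC_gt0.
Qed.

(** The determinant remains the norm of an integral element: when z is replaced by
    z / pi, the determinant is divided by pi pi^*.  This is what allows the
    descent to reach 1, and it makes inert primes occur in z z^* with even
    exponent. *)
Lemma unimodular_overlattice (N : 'M[algC]_3) z : positive_lattice N ->
  inO z -> z != 0 -> \det N = z * z^* ->
  exists N' : 'M[algC]_3, [/\ positive_lattice N', represents N' N & \det N' = 1].
Proof.
move=> posN Oz z0; have [k k_gt0 kE] := norm_gt0 Oz z0.
have [n] := ubnP k; elim: n k N z posN Oz z0 k_gt0 kE => // n IHn k N z posN Oz z0.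
move=> k_gt0 kE le_kn detN; have [k1|k_neq1] := eqVneq k 1%N.
  by exists N; split; rewrite ?detN ?kE ?k1 //; apply: represents_refl.
have p_pr : prime (pdiv k) by apply: pdiv_prime; lia.
set p := pdiv k in p_pr; have p_gt0 := prime_gt0 p_pr.
have p_dvd : (p %| k)%N := pdiv_dvd k.
have [pi hpi Ozpi] : exists2 pi, prime_over p pi & inO (z / pi).
  have [pi hpi] : exists pi, prime_over p pi.
    have [p_in|[pi Opi Npi]] := inert_or_norm p_pr; first by exists p%:R; left.
    by exists pi; right.
  have Ozz : inO (z * z^* / p%:R) by rewrite kE pmulrn; apply/inO_int_div.
  have [h|h] := prime_over_prime p_pr hpi Oz Ozz; first by exists pi.
  by exists pi^* => //; apply: prime_over_conj.
have pi0 := prime_over_neq0 p_pr hpi; have pib0 : pi^* != 0 by rewrite fmorph_eq0.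
have [N1 [posN1 repN1 detN1]] := ternary_step p_pr hpi posN Oz Ozpi detN.
have z'0 : z / pi != 0 by rewrite mulf_neq0 // invr_eq0.
have [k' k'_gt0 k'E] := norm_gt0 Ozpi z'0.
have [q q_gt0 qE] := norm_gt0 (prime_over_inO hpi) pi0.
have kqk : k = (q * k')%N.
  apply/eqP; rewrite -(eqr_nat algC) natrM -kE -qE -k'E conjM conjV; apply/eqP.
  by field; apply/andP.
have q_gt1 : (1 < q)%N.
  suff : q = (p * p)%N \/ q = p by have := prime_gt1 p_pr; nia.
  case: (hpi) qE => [[_ ->]|[_ ->]]; [left|right]; apply/eqP; rewrite -(eqr_nat algC).
    by rewrite natrM -qE conj_nat.
  by rewrite qE.
have [||N' [posN' repN' detN']] := IHn k' N1 (z / pi) posN1 Ozpi z'0 k'_gt0 k'E.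
- by nia.
- apply: (mulfI (mulf_neq0 pi0 pib0)); rewrite -detN1 detN conjM conjV.
  by field; apply/andP.
by exists N'; split=> //; apply: represents_trans repN1.
Qed.

(** * Isometries and reduction of binary lattices *)

(** The equation U V = 1 between integral matrices puts U in GL_n(Z[omega]). *)
Definition isometric n (A A' : 'M[algC]_n) : Prop :=
  exists U V : 'M[algC]_n,
    [/\ mx_over_O U, mx_over_O V, U *m V = 1%:M & A' = U *m A *m U ^t*].

Lemma isometric_trans n (A B C : 'M[algC]_n) :
  isometric A B -> isometric B C -> isometric A C.
Proof.
move=> [U [V [OU OV UV ->]]] [U' [V' [OU' OV' UV' ->]]].
exists (U' *m U), (V *m V'); split; try exact: over_O_mul.
  by rewrite mulmxA -(mulmxA U') UV mulmx1.
by rewrite ctM !mulmxA.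
Qed.

Lemma isometric_sym n (A B : 'M[algC]_n) : isometric A B -> isometric B A.
Proof.
move=> [U [V [OU OV UV ->]]]; have VU := mulmx1C UV.
exists V, U; split=> //.
by rewrite !mulmxA VU mul1mx -mulmxA -ctM VU ct1mx mulmx1.
Qed.

Lemma isometric_represents n (A B : 'M[algC]_n) : isometric A B -> represents A B.
Proof. by move=> [U [V [OU OV UV ->]]]; exists U. Qed.

Lemma over_O_congr m n (X : 'M[algC]_(m, n)) N : mx_over_O X -> mx_over_O N ->
  mx_over_O (X *m N *m X ^t*).
Proof. by move=> *; do ?apply: over_O_mul => //; apply: over_O_ct. Qed.

Lemma isometric_positive n (A B : 'M[algC]_n) :
  isometric A B -> positive_lattice A -> positive_lattice B.
Proof.
move=> [U [V [OU OV UV ->]]] posA; apply: (positive_congr posA (oner_neq0 _)).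
- by rewrite scale1r.
- by have [] := mulmx1_unit UV.
by apply: over_O_congr; case: posA => [[]].
Qed.

(** The norm of a unit of Z[omega] is 1. *)
Lemma isometric_det n (A B : 'M[algC]_n) : isometric A B -> \det B = \det A.
Proof.
move=> [U [V [OU OV UV ->]]]; have dUV : \det U * \det V = 1.
  by rewrite -det_mulmx UV det1.
have [k kE] := norm_inO (inO_det OU); have [l lE] := norm_inO (inO_det OV).
have kl : (k * l == 1)%N.
  by rewrite -(eqr_nat algC) natrM -kE -lE mulrACA -conjM dUV conj1 mulr1.
rewrite !det_mulmx det_ct mulrAC kE; move: kl; rewrite muln_eq1 => /andP [/eqP -> _].
exact: mul1r.
Qed.

Lemma mx22_eta (A : 'M[algC]_2) : A = mx22 (A 0 0) (A 0 1) (A 1 0) (A 1 1).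
Proof.
by apply/matrixP => i j; rewrite mxE; case: i j => [[|[|//]] ?] [[|[|//]] ?];
  congr (A _ _); apply: val_inj.
Qed.

Lemma over_O_mx22 a b c d : inO a -> inO b -> inO c -> inO d ->
  mx_over_O (mx22 a b c d).
Proof. by move=> *; move=> i j; rewrite mxE; do 2?case: ifP. Qed.

Lemma mul_mx22 a b c d a' b' c' d' : mx22 a b c d *m mx22 a' b' c' d' =
  mx22 (a * a' + b * c') (a * b' + b * d') (c * a' + d * c') (c * b' + d * d').
Proof.
apply/matrixP => i j; rewrite mxE !big_ord_recl big_ord0 addr0 !mxE /=.
by case: i j => [[|[|//]] ?] [[|[|//]] ?].
Qed.

Lemma ct_mx22 a b c d : (mx22 a b c d) ^t* = mx22 a^* c^* b^* d^*.
Proof.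
by apply/matrixP => i j; rewrite !mxE; case: i j => [[|[|//]] ?] [[|[|//]] ?].
Qed.

Lemma mx22_1 : 1%:M = mx22 1 0 0 1.
Proof.
by apply/matrixP => i j; rewrite !mxE; case: i j => [[|[|//]] ?] [[|[|//]] ?].
Qed.

Lemma det_mx22 a b c d : \det (mx22 a b c d) = a * d - b * c.
Proof. by rewrite det2E !mxE. Qed.

(** Gauss reduction: a division makes the off-diagonal entry small compared with
    the first diagonal entry, and exchanging the basis vectors decreases the
    latter unless it is the smaller one. *)
Lemma reduce_binary (A : 'M[algC]_2) : positive_lattice A ->
  exists (mu c : nat) (x y : int),
    [/\ isometric A (mx22 mu%:R (oelt x y) (oelt x y)^* c%:R), (0 < mu <= c)%N,
        `|2 * x + y| <= mu%:Z & 11 * onorm x y <= 9 * (mu%:Z * mu%:Z)].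
Proof.
move=> posA; have [a a_gt0 aE] := positive_diag 0 posA.
have [n] := ubnP a; elim: n a A posA a_gt0 aE => // n IHn a A posA a_gt0 aE le_an.
have [[OA hA] _] := posA.
have [|q [x [y [Oq e h1 h2]]]] := @euclid a (A 0 1) _ (OA 0 1); first by lia.
pose A1 := mx22 1 0 (- q^*) 1 *m A *m (mx22 1 0 (- q^*) 1) ^t*.
have isoA1 : isometric A A1.
  exists (mx22 1 0 (- q^*) 1), (mx22 1 0 q^* 1); split=> //.
  - by apply: over_O_mx22; auto with inO.
  - by apply: over_O_mx22; auto with inO.
  by rewrite mul_mx22 mx22_1; congr mx22; ring.
have posA1 := isometric_positive isoA1 posA.
have [c c_gt0 cE] := positive_diag 1 posA1.
have A1E : A1 = mx22 a%:R (oelt x y) (oelt x y)^* c%:R.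
  have A100 : A1 0 0 = a%:R.
    rewrite /A1 [A]mx22_eta ct_mx22 !mul_mx22 !mxE /= !conjE -aE; ring.
  have A101 : A1 0 1 = oelt x y.
    by rewrite -e /A1 [A]mx22_eta ct_mx22 !mul_mx22 !mxE /= !conjE -pmulrn -aE; ring.
  rewrite [LHS]mx22_eta A100 A101 cE; congr mx22.
  by case: posA1 => [[_ hA1] _]; rewrite (herm_entry _ _ hA1) A101.
have [le_ac|lt_ca] := leqP a c.
  by exists a, c, x, y; rewrite -A1E a_gt0 le_ac.
have iso2 : isometric A1 (mx22 c%:R (oelt x y)^* (oelt x y) a%:R).
  exists (mx22 0 1 1 0), (mx22 0 1 1 0); split.
  - by apply: over_O_mx22; auto with inO.
  - by apply: over_O_mx22; auto with inO.
  - by rewrite mul_mx22 mx22_1; congr mx22; ring.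
  by rewrite A1E ct_mx22 !mul_mx22 conj0 conj1; congr mx22; ring.
have iso := isometric_trans isoA1 iso2.
have [||mu [c' [x' [y' [iso' h3 h4 h5]]]]] := IHn c _ (isometric_positive iso posA) c_gt0.
- by rewrite mxE.
- by lia.
by exists mu, c', x', y'; split=> //; apply: isometric_trans iso'.
Qed.

(** For a reduced plane of determinant m one has
    11 m = 11 mu c - 11 |b|^2 >= 2 mu^2 >= 2 m^2, so m <= 5 and only finitely many
    pairs (m, mu) remain.  Moreover 4 (mu c - m) = 4 |b|^2 = X^2 + 11 y^2, where
    X = 2 x + y satisfies |X| <= mu; for m > 1 this leaves a single possibility,
    the plane 2 B up to isometry. *)
Lemma reduced_bound (m mu c : nat) (x y : int) : (0 < m)%N -> (m <= mu <= c)%N ->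
  mu%:Z * c%:Z - onorm x y = m -> `|2 * x + y| <= mu%:Z ->
  11 * onorm x y <= 9 * (mu%:Z * mu%:Z) ->
  m = 1%N \/ [/\ mu = 4%N, c = 4%N & exists x' y', x = 2 * x' /\ y = 2 * y'].
Proof.
move=> m0 /andP [m_mu mu_c] e h1 h2.
have mu_m : 2 * (mu%:Z * mu%:Z) <= 11 * m%:Z by nia.
have mu5 : (mu <= 5)%N by nia.
have N4 : 4 * onorm x y = (2 * x + y) * (2 * x + y) + 11 * (y * y).
  by rewrite /onorm; ring.
have y2 : -2 <= y <= 2 by nia.
have NX : 4 * (mu%:Z * c%:Z - m%:Z) = (2 * x + y) * (2 * x + y) + 11 * (y * y).
  by rewrite -N4; lia.
have yE : y = -2 \/ y = -1 \/ y = 0 \/ y = 1 \/ y = 2 by lia.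
have [X XE] : exists X, X = 2 * x + y by exists (2 * x + y).
rewrite -XE in h1 NX.
have XX : X * X \in [:: 0; 1; 4; 9; 16; 25].
  have : X = -5 \/ X = -4 \/ X = -3 \/ X = -2 \/ X = -1 \/ X = 0 \/
         X = 1 \/ X = 2 \/ X = 3 \/ X = 4 \/ X = 5 by lia.
  by do 10?[case=> [->//|]]; move=> ->.
have yy : y * y \in [:: 0; 1; 4] by move: yE; do 4?[case=> [->//|]]; move=> ->.
have XXmu : X * X <= mu%:Z * mu%:Z by nia.
have c_bound : 11 * (mu%:Z * c%:Z - m%:Z) <= 9 * (mu%:Z * mu%:Z) by lia.
have mmu : (m, mu) \in [:: (2, 2); (2, 3); (3, 3); (3, 4); (4, 4); (5, 5)]%N \/ m = 1%N.
  move: m0 m_mu mu5 mu_m; clear.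
  by case: m => [|[|[|[|[|[|m]]]]]] //; try lia; try (by right);
  case: mu => [|[|[|[|[|[|mu]]]]]] //; try lia; left.
case: mmu => [mmu|->]; [right|by left].
have [mu4 [c4 [XX4 yy4]]] : mu = 4%N /\ c = 4%N /\ X * X = 4 /\ y * y = 4.
  move: XX yy mmu XXmu NX mu_c c_bound; clear; rewrite !inE.
  by do 5?[case/orP]; move=> /eqP ->; do 2?[case/orP]; move=> /eqP ->;
     do 5?[case/orP]; move=> /eqP [-> ->]; lia.
split=> //; have [->|->] : y = 2 \/ y = - 2 by nia.
  by exists (x %/ 2)%Z, 1; split=> //; nia.
by exists (x %/ 2)%Z, (- 1); split=> //; nia.
Qed.

(** * Binary and ternary unimodular lattices *)

Definition plane_B : 'M[algC]_2 := mx22 2%:R omega omega^* 2%:R.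

Lemma isometric_refl n (A : 'M[algC]_n) : isometric A A.
Proof.
exists 1%:M, 1%:M; split; try exact: over_O_1; first by rewrite mulmx1.
by rewrite ct1mx mulmx1 mul1mx.
Qed.

Lemma isometric_mx22 (e f g h : algC) (A A' : 'M[algC]_2) :
  inO e -> inO f -> inO g -> inO h ->
  mx22 e f g h *m (mx22 e f g h) ^t* = 1%:M ->
  A' = mx22 e f g h *m A *m (mx22 e f g h) ^t* -> isometric A A'.
Proof.
move=> *; exists (mx22 e f g h), ((mx22 e f g h) ^t*); split=> //.
  exact: over_O_mx22.
by apply/over_O_ct/over_O_mx22.
Qed.

(** The four values omega, - omega, omega^*, - omega^* of the off-diagonal entry
    occur for mu = 2. *)
Lemma reduced_unimodular (mu c : nat) (x y : int) : (0 < mu <= c)%N ->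
  mu%:Z * c%:Z - onorm x y = 1 -> `|2 * x + y| <= mu%:Z ->
  11 * onorm x y <= 9 * (mu%:Z * mu%:Z) ->
  [/\ mu = 1%N, c = 1%N, x = 0 & y = 0] \/
  [/\ mu = 2%N, c = 2%N &
    [\/ (x = 0 /\ y = 1), (x = 0 /\ y = -1), (x = 1 /\ y = -1) |
        (x = -1 /\ y = 1)]].
Proof.
move=> /andP [mu0 mu_c] e h1 h2.
have N4 : 4 * onorm x y = (2 * x + y) * (2 * x + y) + 11 * (y * y).
  by rewrite /onorm; ring.
have mu2 : (mu <= 2)%N by nia.
have [muE|muE] : mu = 1%N \/ mu = 2%N by lia.
  rewrite muE in e h1 h2 *; left.
  have c1 : c = 1%N by have := onorm_ge0 x y; lia.
  have y0 : y = 0 by nia.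
  by split=> //; nia.
rewrite muE in e h1 h2 mu_c *; right.
have c2 : c = 2%N by lia.
have N3 : onorm x y = 3 by lia.
have [yE|yE] : y = 1 \/ y = -1.
- have : -1 <= y <= 1 by nia.
  have : y != 0 by apply/eqP => y0; rewrite N3 y0 in N4; nia.
  lia.
- rewrite N3 yE in N4; have [xE|xE] : 2 * x + 1 = 1 \/ 2 * x + 1 = -1 by nia.
    by split=> //; constructor 1; lia.
  by split=> //; constructor 4; lia.
rewrite N3 yE in N4; have [xE|xE] : 2 * x + -1 = 1 \/ 2 * x + -1 = -1 by nia.
  by split=> //; constructor 3; lia.
by split=> //; constructor 2; lia.
Qed.

Lemma binary_unimodular (A : 'M[algC]_2) : positive_lattice A -> \det A = 1 ->
  isometric A 1%:M \/ isometric A plane_B.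
Proof.
move=> posA detA; have [mu [c [x [y [iso mu_c h1 h2]]]]] := reduce_binary posA.
have e : mu%:Z * c%:Z - onorm x y = 1.
  apply/eqP; rewrite -(eqr_int algC) intrB intrM -!pmulrn -onormE.
  by rewrite -det_mx22 (isometric_det iso) detA.
have [[muE cE xE yE]|[muE cE h]] := reduced_unimodular mu_c e h1 h2.
  left; congr isometric: iso.
  by rewrite mx22_1 muE cE xE yE -oelt_int conj_int.
right; apply: isometric_trans iso _; rewrite muE cE.
have xyE u v : oelt u v = u%:~R + v%:~R * omega by [].
case: h => [[-> ->]|[-> ->]|[-> ->]|[-> ->]].
- have -> : oelt 0 1 = omega by rewrite xyE; ring.
  exact: isometric_refl.
- apply: (@isometric_mx22 1 0 0 (- 1)); auto with inO;
    rewrite ct_mx22 ?mx22_1 !mul_mx22 /plane_B; congr mx22;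
    by rewrite ?xyE !conjE; ring.
- apply: (@isometric_mx22 0 1 1 0); auto with inO;
    rewrite ct_mx22 ?mx22_1 !mul_mx22 /plane_B; congr mx22;
    by rewrite ?xyE !conjE; ring.
apply: (@isometric_mx22 0 1 (- 1) 0); auto with inO;
  rewrite ct_mx22 ?mx22_1 !mul_mx22 /plane_B; congr mx22;
  by rewrite ?xyE !conjE; ring.
Qed.

Lemma ct_block m1 m2 n1 n2 (A : 'M[algC]_(m1, n1)) (B : 'M_(m1, n2))
    (C : 'M_(m2, n1)) (D : 'M_(m2, n2)) :
  (block_mx A B C D) ^t* = block_mx (A ^t*) (C ^t*) (B ^t*) (D ^t*).
Proof. by rewrite tr_block_mx map_block_mx. Qed.

Lemma ct0mx m n : (0 : 'M[algC]_(m, n)) ^t* = 0.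
Proof. by rewrite trmx0 map_mx0. Qed.

Lemma represents_block m n m' n' (A : 'M[algC]_m) (C : 'M[algC]_n)
    (A' : 'M[algC]_m') (C' : 'M[algC]_n') :
  represents A A' -> represents C C' ->
  represents (block_mx A 0 0 C) (block_mx A' 0 0 C').
Proof.
move=> [X [OX ->]] [Y [OY ->]]; exists (block_mx X 0 0 Y); split.
  by apply: over_O_block => //; apply: over_O_0.
by rewrite ct_block !ct0mx !mulmx_block !(mul0mx, mulmx0, addr0, add0r).
Qed.

Lemma isometric_ul m n (M : 'M[algC]_(m + n)) A' : isometric (ulsubmx M) A' ->
  exists2 M', isometric M M' & ulsubmx M' = A'.
Proof.
move=> [U [V [OU OV UV ->]]].
have O1 := @over_O_1 n; have O0 := over_O_0.
exists (block_mx U 0 0 1%:M *m M *m (block_mx U 0 0 1%:M) ^t*).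
  exists (block_mx U 0 0 1%:M), (block_mx V 0 0 1%:M); split=> //.
  - exact: over_O_block.
  - exact: over_O_block.
  by rewrite mulmx_block UV !(mul0mx, mulmx0, addr0, add0r, mulmx1) -scalar_mx_block.
rewrite -[M in LHS]submxK ct_block !ct0mx !mulmx_block block_mxKul.
by rewrite !(mul0mx, mulmx0, addr0).
Qed.

Lemma positive_ul m n (M : 'M[algC]_(m + n)) :
  positive_lattice M -> positive_lattice (ulsubmx M).
Proof.
move=> [[OM hM] posM]; split.
  split; first by move=> i j; rewrite !mxE.
  by apply/matrixP=> i j; rewrite ctE !mxE (herm_entry _ _ hM).
move=> x Ox x0; have Oz : mx_over_O (row_mx x (0 : 'rV_n)).
  by apply: over_O_row => //; apply: over_O_0.
have z0 : row_mx x (0 : 'rV_n) != 0.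
  by apply: contraNneq x0 => /(congr1 lsubmx); rewrite row_mxKl linear0 => ->.
have := posM _ Oz z0; rewrite /herm_form -{1}[M]submxK mul_row_block.
by rewrite tr_row_mx map_col_mx mul_row_col trmx0 map_mx0 !(mul0mx, mulmx0, addr0).
Qed.

Lemma isometric_perm n (s : 'S_n) (M : 'M[algC]_n) :
  isometric M (\matrix_(i, j) M (s i) (s j)).
Proof.
have OP t : mx_over_O (perm_mx t : 'M[algC]_n).
  by move=> i j; rewrite !mxE; apply: inO_nat.
exists (perm_mx s), (perm_mx s^-1%g); split=> //.
  by rewrite -perm_mxM mulgV perm_mx1.
rewrite tr_perm_mx map_perm_mx -row_permE -col_permE.
by apply/matrixP => i j; rewrite !mxE.
Qed.

(** In the expansion along the last row each minor involves the rows 0 and 1 and at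
    least one of the columns 0 and 1. *)
Lemma even_ul_det (M : 'M[algC]_(2 + 1)) : mx_over_O M ->
  (forall i j, inO (ulsubmx M i j / 2%:R)) -> inO (\det M / 2%:R).
Proof.
move=> OM even; have even' (i j : 'I_(2 + 1)) :
    (i < 2)%N -> (j < 2)%N -> inO (M i j / 2%:R).
  move=> hi hj; have := even (Ordinal hi) (Ordinal hj); rewrite !mxE.
  by congr (inO (M _ _ / _)); apply: val_inj.
rewrite (expand_det_row _ ord_max) mulr_suml; apply: inO_sum => j _.
rewrite -mulrA; apply: inOM => //; rewrite /cofactor -mulrA; apply: inOM.
  by rewrite -signr_odd; case: odd; rewrite ?expr0 ?expr1; auto with inO.
have lt_j : (lift j (0%R : 'I_2) < 2)%N by case: j => [[|[|[|//]]] ?].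
rewrite det2E !mxE mulrBl; apply: inOB.
  by rewrite mulrAC; apply: inOM => //; apply: even'.
by rewrite -mulrA; apply: inOM => //; apply: even'.
Qed.

Lemma adjugate_corner (M : 'M[algC]_(2 + 1)) :
  \adj M ord_max ord_max = \det (ulsubmx M).
Proof.
rewrite mxE /cofactor -signr_odd /= expr0 mul1r !det2E !mxE.
by congr (M _ _ * M _ _ - M _ _ * M _ _); apply: val_inj.
Qed.

(** A unimodular lattice is its own dual: the inverse Gram matrix is the Gram
    matrix in the dual basis. *)
Lemma isometric_adjugate n (N : 'M[algC]_n) : mx_over_O N -> N = N ^t* ->
  \det N = 1 -> isometric N (\adj N) /\ \adj (\adj N) = N.
Proof.
move=> ON hN detN.
have NA : N *m \adj N = 1%:M by rewrite mul_mx_adj detN.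
have AN : \adj N *m N = 1%:M by rewrite mul_adj_mx detN.
have detA : \det (\adj N) = 1.
  by have := congr1 determinant NA; rewrite det_mulmx detN mul1r det1.
split; last first.
  by rewrite -[LHS]mulmx1 -AN mulmxA mul_adj_mx detA mul1mx.
exists (\adj N), N; split=> //; first exact: over_O_adjugate.
by rewrite trmx_adj map_mx_adj -hN -mulmxA NA mulmx1.
Qed.

Lemma split_unit_vector (N : 'M[algC]_(2 + 1)) : positive_lattice N ->
  \det N = 1 -> N ord_max ord_max = 1 ->
  exists A : 'M[algC]_2, [/\ positive_lattice A, \det A = 1 &
                          isometric N (block_mx A 0 0 1%:M)].
Proof.
move=> posN detN N1; have [[ON hN] _] := posN.
pose u := ursubmx N; pose A := ulsubmx N - u *m u ^t*.
have Ou : mx_over_O u by move=> i j; rewrite !mxE.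
have dr : drsubmx N = 1%:M.
  by apply/matrixP => i j; rewrite !ord1 !mxE -N1; congr (N _ _); apply: val_inj.
have dl : dlsubmx N = u ^t*.
  by apply/matrixP => i j; rewrite ctE !mxE (herm_entry _ _ hN).
have O1 n := @over_O_1 n; have O0 := over_O_0.
have iso : isometric N (block_mx A 0 0 1%:M).
  exists (block_mx 1%:M (- u) 0 1%:M), (block_mx 1%:M u 0 1%:M); split.
  - by apply: over_O_block => // i j; rewrite mxE; apply: inON.
  - exact: over_O_block.
  - rewrite mulmx_block !(mul0mx, mulmx0, mul1mx, mulmx1, addr0, add0r) subrr.
    by rewrite -scalar_mx_block.
  rewrite -[N]submxK dr dl ct_block !ct1mx ct0mx !mulmx_block.
  rewrite !(mul0mx, mulmx0, mul1mx, mulmx1, addr0, add0r) !mulNmx.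
  have -> : (- u) ^t* = - u ^t* by apply/matrixP => i j; rewrite !mxE conjN.
  by rewrite mulmxN !subrr mul0mx oppr0 addr0.
exists A; split=> //.
  by have := positive_ul (isometric_positive iso posN); rewrite block_mxKul.
by have := isometric_det iso; rewrite det_ublock det1 mulr1 detN.
Qed.

(** Induction on the last diagonal entry m of N.  The upper left block of the
    adjugate has determinant m; once it is reduced, its first entry mu is a
    diagonal entry of a lattice isometric to N, so the induction hypothesis
    settles the case mu < m.  For mu >= m > 1 the reduced block is divisible by
    2, which contradicts determinant 1. *)
Lemma ternary_unimodular (N : 'M[algC]_(2 + 1)) : positive_lattice N ->
  \det N = 1 -> represents (1%:M : 'M_(2 + 1)) N \/
    represents (block_mx plane_B 0 0 1%:M : 'M_(2 + 1)) N.
Proof.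
move=> posN detN; have [m m_gt0 mE] := positive_diag ord_max posN.
have [n] := ubnP m; elim: n m N posN detN m_gt0 mE => // n IHn m N posN detN.
move=> m_gt0 mE le_mn; have [[ON hN] _] := posN.
have [m1|m_neq1] := eqVneq m 1%N.
  have [|A [posA detA iso]] := split_unit_vector posN detN; first by rewrite mE m1.
  have repN : represents (block_mx A 0 0 1%:M : 'M_(2 + 1)) N.
    exact: (isometric_represents (isometric_sym iso)).
  have rep1 := @represents_refl 1 1%:M.
  have [isoA|isoA] := binary_unimodular posA detA; [left|right];
    apply: represents_trans repN; rewrite ?(scalar_mx_block 2 1);
    exact: (represents_block (isometric_represents (isometric_sym isoA)) rep1).
have [isoM ctM'] := isometric_adjugate ON hN detN; set M := \adj N in isoM ctM'.
have posM := isometric_positive isoM posN.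
have detM : \det M = 1 by rewrite (isometric_det isoM).
have [mu [c [x [y [isoA /andP [mu_gt0 mu_c] h1 h2]]]]] := reduce_binary (positive_ul posM).
have [M' isoM' ulM'] := isometric_ul isoA.
have isoN := isometric_trans isoM isoM'.
have [lt_mu|le_mu] := ltnP mu m.
  have iso2 := isometric_perm (tperm 0 ord_max) M'; set M2 := (\matrix_(_, _) _) in iso2.
  have iso := isometric_trans isoN iso2.
  have repN : represents M2 N by exact: (isometric_represents (isometric_sym iso)).
  have M2E : M2 ord_max ord_max = mu%:R.
    have := congr1 (fun A : 'M_2 => A 0 0) ulM'; rewrite !mxE tpermR /= => <-.
    by congr (M' _ _); apply: val_inj.
  have det2 : \det M2 = 1 by rewrite (isometric_det iso).
  have [|rep|rep] := IHn mu M2 (isometric_positive iso posN) det2 mu_gt0 M2E.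
  - by lia.
  - by left; apply: represents_trans repN.
  by right; apply: represents_trans repN.
have e : mu%:Z * c%:Z - onorm x y = m.
  apply/eqP; rewrite -(eqr_int algC) intrB intrM -!pmulrn -onormE.
  by rewrite -det_mx22 (isometric_det isoA) -mE -adjugate_corner ctM'.
have [|m1|[muE cE [x' [y' [xE yE]]]]] := reduced_bound m_gt0 _ e h1 h2.
- by rewrite le_mu.
- by rewrite m1 in m_neq1.
have [[OM' _] _] := isometric_positive isoM' posM.
have : inO (\det M' / 2%:R).
  apply: even_ul_det => // i j; rewrite ulM' muE cE.
  have Ob : inO (oelt x y / 2%:R) by apply/inO_oelt_div => //; rewrite xE yE; lia.
  have Ob' := inO_conj Ob; rewrite conjM conjV conj_nat in Ob'.
  have O4 : inO (4%:R / 2%:R).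
    by have -> : 4%:R / 2%:R = 2%:R :> algC; [field|auto with inO].
  by rewrite mxE; do 2?case: ifP.
rewrite (isometric_det isoM') detM => h.
by have /inO_int_div : inO (1%:~R / 2%:R); last by move=> /(_ isT).
Qed.

(** * Sums of three norms and neighbours at omega *)

Definition quaternary : 'M[algC]_(2 + 2) := block_mx 1%:M 0 0 plane_B.

(** The hermitian form of [plane_B] between the vectors (g, h) and (g', h'). *)
Definition formB (g h g' h' : algC) : algC :=
  2%:R * g * g'^* + omega * g * h'^* + omega^* * h * g'^* + 2%:R * h * h'^*.

(** On the sublattice a + b = 0 mod omega of I_2 the form of I_2 is that of B
    restricted to a sublattice: the vectors (1, -1) and
    (-1 - omega, 1) / omega^* have Gram matrix B, and - t - b, - omega^* t are the
    coordinates of (a, b) in this basis. *)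
Lemma formB_pair (a b t a' b' t' : algC) :
  a + b = omega * t -> a' + b' = omega * t' ->
  a * a'^* + b * b'^*
    = formB (- t - b) (- omega^* * t) (- t' - b') (- omega^* * t').
Proof.
move=> /(canRL (addrK b)) -> /(canRL (addrK b')) ->.
have w2 := omega_sqr; rewrite /formB !conjE; ring: w2.
Qed.

(** The neighbour of I_3 for the congruence a + b + c = 0 mod omega is I_1 + B: the
    first summand is spanned by (1, 1, 1) / omega^*, and the second one by
    (2, -1, -1) / omega^* and (1, -1, 0), whose Gram matrix is B. *)
Lemma formB_triple (a b c t a' b' c' t' : algC) :
  a + b + c = omega * t -> a' + b' + c' = omega * t' ->
  a * a'^* + b * b'^* + c * c'^* = t * t'^*
    + formB (t - omega^* * c) (c - b) (t' - omega^* * c') (c' - b').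
Proof.
move=> e e'; have -> : a = omega * t - b - c by rewrite -e; ring.
have -> : a' = omega * t' - b' - c' by rewrite -e'; ring.
have w2 := omega_sqr; rewrite /formB !conjE; ring: w2.
Qed.

Lemma represents_quaternary (l : 'M[algC]_2) (p q g h : 'I_2 -> algC) :
  (forall i, [/\ inO (p i), inO (q i), inO (g i) & inO (h i)]) ->
  (forall i j, l i j = p i * (p j)^* + q i * (q j)^*
                       + formB (g i) (h i) (g j) (h j)) ->
  represents quaternary l.
Proof.
move=> Oc lE.
exists (row_mx (mx22 (p 0) (q 0) (p 1) (q 1)) (mx22 (g 0) (h 0) (g 1) (h 1))).
have [O0 O1] := (Oc 0, Oc 1); split.
  by apply: over_O_row; apply: over_O_mx22; case: O0 => *; case: O1.
rewrite /quaternary mul_row_block !(mulmx0, addr0, add0r, mulmx1).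
rewrite tr_row_mx map_col_mx mul_row_col !ct_mx22 !mul_mx22 [LHS]mx22_eta !lE.
rewrite [RHS]mx22_eta !mxE /= /formB.
by congr mx22; ring.
Qed.

(** The residue field of omega has 3 elements, and residues there are those of the
    integral coordinate, since 3 = omega omega^*.  Three vectors of a plane over
    this field are dependent; the coefficients lift to -1, 0, 1. *)
Lemma dependent_columns (X : 'M[algC]_(2, 3)) : mx_over_O X ->
  exists (e : 'I_3 -> int) (t : 'I_2 -> algC),
    [/\ forall k, e k \in [:: -1; 0; 1], exists k, e k != 0,
        forall i, inO (t i) &
        forall i, \sum_k (e k)%:~R * X i k = omega * t i].
Proof.
move=> OX.
have [a [b Xab]] : exists a b : 'I_2 -> 'I_3 -> int,
    forall i k, X i k = oelt (a i k) (b i k).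
  have ab i k : exists u : int * int, X i k == oelt u.1 u.2.
    by have /inOP [u [v ->]] := OX i k; exists (u, v).
  exists (fun i k => (xchoose (ab i k)).1), (fun i k => (xchoose (ab i k)).2).
  by move=> i k; apply/eqP/(xchooseP (ab i k)).
pose A : 'M['F_3]_(3, 2) := \matrix_(k, i) (a i k)%:~R.
have : kermx A != 0.
  rewrite kermx_eq0 /row_free; apply/negP => /eqP rk.
  by have := rank_leq_col A; rewrite rk.
case/rowV0Pn => w /sub_kermxP wA w0.
have lift3 (x : 'F_3) : exists e : int, (e \in [:: -1; 0; 1]) && (e%:~R == x).
  by case: x => [[|[|[|//]]] ?]; [exists 0|exists 1|exists (-1)].
pose e k := xchoose (lift3 (w 0 k)).
have eE k : e k \in [:: -1; 0; 1] /\ (e k)%:~R = w 0 k.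
  by have /andP [? /eqP] := xchooseP (lift3 (w 0 k)).
have [q qE] : exists q : 'I_2 -> int, forall i, \sum_k e k * a i k = q i * 3.
  have dvd i : exists q : int, \sum_k e k * a i k == q * 3.
    have : (3 %| \sum_k e k * a i k)%Z.
      rewrite (@dvdz_pcharf 'F_3 3) ?pchar_Fp // rmorph_sum /=.
      have := congr1 (fun M : 'rV_2 => M 0 i) wA; rewrite !mxE => {2}<-.
      apply/eqP; apply: eq_bigr => k _.
      by rewrite mxE intrM (eE k).2.
    by case/dvdzP => q ->; exists q.
  exists (fun i => xchoose (dvd i)) => i; exact/eqP/(xchooseP (dvd i)).
exists e, (fun i => omega^* * (q i)%:~R + \sum_k (e k)%:~R * (b i k)%:~R).
split.
- by move=> k; case: (eE k).
- have [k wk] := rV0Pn _ w0; exists k; apply: contraNneq wk => ek0.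
  by rewrite -(eE k).2 ek0.
- move=> i; apply: inOD; first by auto with inO.
  by apply: inO_sum => k _; auto with inO.
move=> i; have w2 := omega_sqr.
have -> : \sum_k (e k)%:~R * X i k
  = (\sum_k e k * a i k)%:~R + omega * \sum_k (e k)%:~R * (b i k)%:~R.
  rewrite rmorph_sum /= mulr_sumr -big_split /=; apply: eq_bigr => k _.
  by rewrite Xab /oelt intrM; ring.
rewrite qE intrM conj_omega; ring: w2.
Qed.

(** Multiplying columns by the signs occurring in the dependence relation does not
    change X X^*, so the relation says that the sum of one, two or three columns
    vanishes modulo omega.  A single column is paired with a zero column. *)
Lemma three_squares_to_quaternary (l : 'M[algC]_2) :
  represents (1%:M : 'M_3) l -> represents quaternary l.
Proof.
move=> [X [OX lE]]; have [e [t [eS [k0 k0P] Ot dep]]] := dependent_columns OX.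
pose s k : algC := if e k == 0 then 1 else (e k)%:~R.
pose C k i := s k * X i k.
have OC k i : inO (C k i).
  by rewrite /C /s; case: ifP => _; auto with inO.
have ss k : s k * (s k)^* = 1.
  rewrite /s; have := eS k; rewrite !inE.
  by case/or3P => /eqP -> /=; rewrite !conjE; ring.
have lC i j : l i j = C 0 i * (C 0 j)^* + C 1 i * (C 1 j)^* + C 2%:R i * (C 2%:R j)^*.
  have CC k : C k i * (C k j)^* = X i k * (X j k)^*.
    by rewrite /C conjM mulrACA ss mul1r.
  rewrite !CC lE mulmx1 mxE !big_ord_recl big_ord0 addr0 addrA !ctE.
  by congr (_ * (_)^* + _ * (_)^* + _ * (_)^*); congr (X _ _); apply: val_inj.
pose b k := e k != 0.
have depC i : (b 0)%:R * C 0 i + (b 1)%:R * C 1 i + (b 2%:R)%:R * C 2%:R i = omega * t i.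
  have bC k : (b k)%:R * C k i = (e k)%:~R * X i k.
    rewrite /b /C /s; have [->|_] := eqVneq (e k) 0; first by rewrite !mul0r.
    by rewrite mul1r.
  rewrite !bC -dep !big_ord_recl big_ord0 addr0 addrA.
  by congr (_%:~R * _ + _%:~R * _ + _%:~R * _); try congr (X _ _); try congr e; apply: val_inj.
have some_b : [|| b 0, b 1 | b 2%:R].
  rewrite -[b 0]orFb; move: k0P; rewrite -/(b k0).
  have [->|->|->] : [\/ k0 = 0, k0 = 1 | k0 = 2%:R].
    by case: {+}k0 => [[|[|[|//]]] ?]; [constructor 1|constructor 2|constructor 3]; apply: val_inj.
  - by move=> ->.
  - by move=> ->; rewrite orbT.
  by move=> ->; rewrite !orbT.
have pair i0 i1 i2 : [/\ forall i j, l i j = C i0 i * (C i0 j)^* + C i1 i * (C i1 j)^* + C i2 i * (C i2 j)^*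
      & forall i, C i1 i + C i2 i = omega * t i] -> represents quaternary l.
  move=> [lE' h]; apply: (@represents_quaternary l (C i0) (fun=> 0)
     (fun i => - t i - C i2 i) (fun i => - omega^* * t i)).
    by move=> i; split; auto with inO.
  move=> i j; rewrite mul0r addr0 -(formB_pair (h i) (h j)) addrA; exact: lE'.
have single i0 i1 i2 : [/\ forall i j, l i j = C i0 i * (C i0 j)^* + C i1 i * (C i1 j)^* + C i2 i * (C i2 j)^*
      & forall i, C i2 i = omega * t i] -> represents quaternary l.
  move=> [lE' h]; apply: (@represents_quaternary l (C i0) (C i1)
     (fun i => - t i - C i2 i) (fun i => - omega^* * t i)).
    by move=> i; split; auto with inO.
  have h0 i : 0 + C i2 i = omega * t i by rewrite add0r.
  by move=> i j; rewrite -(formB_pair (h0 i) (h0 j)) mul0r add0r; exact: lE'.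
move: some_b depC; case: (b 0); case: (b 1); case: (b 2%:R) => //= _ depC.
- apply: (@represents_quaternary l t (fun=> 0)
     (fun i => t i - omega^* * C 2%:R i) (fun i => C 2%:R i - C 1 i)).
    by move=> i; split; auto with inO.
  have h i : C 0 i + C 1 i + C 2%:R i = omega * t i by rewrite -depC; ring.
  by move=> i j; rewrite mul0r addr0 lC; exact: formB_triple.
- apply: (pair 2%:R 0 1); split=> [i j|i]; [rewrite lC|rewrite -depC]; ring.
- apply: (pair 1 0 2%:R); split=> [i j|i]; [rewrite lC|rewrite -depC]; ring.
- apply: (single 1 2%:R 0); split=> [i j|i]; [rewrite lC|rewrite -depC]; ring.
- apply: (pair 0 1 2%:R); split=> [i j|i]; [rewrite lC|rewrite -depC]; ring.
- apply: (single 0 2%:R 1); split=> [i j|i]; [rewrite lC|rewrite -depC]; ring.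
- apply: (single 0 1 2%:R); split=> [i j|i]; [rewrite lC|rewrite -depC]; ring.
Qed.

(** * Representation of all binary lattices *)

Lemma quaternary_represents_sum :
  represents quaternary (block_mx plane_B 0 0 1%:M : 'M_(2 + 1)).
Proof.
have O0 := over_O_0; have O1 := @over_O_1 2.
pose e : 'rV[algC]_2 := delta_mx 0 0.
have Oe : mx_over_O e by move=> i j; rewrite mxE; apply: inO_nat.
have ee : e *m e ^t* = 1%:M.
  rewrite trmx_delta map_delta_mx mul_delta_mx.
  by apply/matrixP => i j; rewrite !ord1 !mxE !eqxx.
exists (block_mx 0 1%:M e 0); split; first exact: over_O_block.
rewrite /quaternary ct_block !ct0mx ct1mx !mulmx_block.
by rewrite !(mul0mx, mulmx0, mul1mx, mulmx1, addr0, add0r) ee.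
Qed.

(** In a reduced plane 11 |b|^2 <= 9 mu^2 < 11 mu c. *)
Lemma binary_det_gt0 (l : 'M[algC]_2) : positive_lattice l ->
  exists2 d : nat, (0 < d)%N & \det l = d%:R.
Proof.
move=> posl; have [mu [c [x [y [iso /andP [mu_gt0 mu_c] _ h]]]]] := reduce_binary posl.
have := isometric_det iso; rewrite det_mx22 onormE => <-.
exists (mu * c - `|onorm x y|)%N; first by have := onorm_ge0 x y; nia.
apply/eqP; rewrite !pmulrn -intrM -intrB eqr_int.
have := onorm_ge0 x y; nia.
Qed.

Lemma positive_block_diag (l : 'M[algC]_2) (d : nat) : positive_lattice l ->
  (0 < d)%N -> positive_lattice (block_mx l 0 0 d%:R%:M : 'M_(2 + 1)).
Proof.
move=> [[Ol hl] posl] d_gt0; split; first split.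
- apply: over_O_block => //; try exact: over_O_0.
  by move=> i j; rewrite !ord1 mxE eqxx mulr1n; auto with inO.
- rewrite ct_block -hl !ct0mx; congr block_mx.
  by apply/matrixP => i j; rewrite !ord1 ctE !mxE eqxx !mulr1n conj_nat.
move=> x; rewrite -[x]hsubmxK; set y := lsubmx x; set z := rsubmx x => Ox x0.
have -> : herm_form (block_mx l 0 0 d%:R%:M : 'M_(2 + 1)) (row_mx y z) (row_mx y z)
   = herm_form l y y + d%:R * (z 0 0 * (z 0 0)^*).
  rewrite /herm_form mul_row_block tr_row_mx map_col_mx mul_row_col.
  rewrite !(mulmx0, addr0, add0r) mxE; congr (_ + _).
  by rewrite mul_mx_scalar -scalemxAl mxE; congr (_ * _); rewrite mxE big_ord1 ctE.
have Oy : mx_over_O y by move=> i j; rewrite /y -[x]hsubmxK row_mxKl; have := Ox i (lshift _ j); rewrite row_mxEl.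
have d0 : 0 < d%:R :> algC by rewrite ltr0n.
have [y0|y0] := eqVneq y 0; last first.
  by apply: ltr_wpDr; [rewrite mulr_ge0 ?ler0n ?mul_conjC_ge0|exact: posl].
have z0 : z 0 0 != 0.
  apply: contraNneq x0 => z0; rewrite y0 [z](_ : _ = 0) ?row_mx0 //.
  by apply/matrixP => i j; rewrite !ord1 z0 mxE.
by rewrite y0 /herm_form !mul0mx mxE add0r mulr_gt0 // mul_conjC_gt0.
Qed.

Lemma quaternary_universal (l : 'M[algC]_2) :
  positive_lattice l -> represents quaternary l.
Proof.
move=> posl; have [d d_gt0 dE] := binary_det_gt0 posl.
pose N : 'M[algC]_(2 + 1) := block_mx l 0 0 d%:R%:M.
have posN : positive_lattice N by apply: positive_block_diag.
have detN : \det N = d%:R * (d%:R)^*.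
  by rewrite det_ublock dE det_scalar1 conj_nat.
have d0 : d%:R != 0 :> algC by rewrite pnatr_eq0 -lt0n.
have repl : represents N l.
  exists (row_mx 1%:M 0); split.
    by apply: over_O_row; [exact: over_O_1|exact: over_O_0].
  rewrite mul_row_block tr_row_mx map_col_mx mul_row_col ct1mx ct0mx.
  by rewrite !(mul1mx, mul0mx, mulmx0, mulmx1, addr0).
have [N' [posN' repN' detN']] := unimodular_overlattice posN (inO_nat d) d0 detN.
have repl' := represents_trans repN' repl.
have [rep|rep] := ternary_unimodular posN' detN'.
  by apply: three_squares_to_quaternary; apply: represents_trans rep repl'.
apply: represents_trans quaternary_represents_sum _.
exact: represents_trans rep repl'.
Qed.

(** * Orthogonal splitting of the two planes *)

(** Twice the form inverse to that of [plane_B] is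
    |2 c1 - omega^* c2|^2 + |c2|^2.  Two norms with sum at most 2 are norms of
    rational integers, so 2 c1 - omega^* c2 is one, which for an integer c2
    forces c2 to be even. *)
Lemma plane_B_inverse_small (c1 c2 : algC) (k : int) : inO c1 -> inO c2 ->
  2%:R * c1 * c1^* - omega * c1 * c2^* - omega^* * c2 * c1^* + 2%:R * c2 * c2^*
    = k%:~R -> k <= 1 -> c1 = 0 /\ c2 = 0.
Proof.
move=> /inOP [x [y ->]] /inOP [z [u ->]] kE k1.
have w2 := omega_sqr.
have sq : onorm (2 * x - (z + 3 * u)) (2 * y + z) + onorm z u = 2 * k.
  apply/eqP; rewrite -(eqr_int algC) intrD intrM -kE -!onormE; apply/eqP.
  have -> : oelt (2 * x - (z + 3 * u)) (2 * y + z)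
     = 2%:R * oelt x y - omega^* * oelt z u.
    rewrite /oelt conj_omega; ring: w2.
  rewrite !conj_oelt /oelt !conjE; ring: w2.
set X := 2 * x - (z + 3 * u) in sq; set Y := 2 * y + z in sq.
have bound a b : onorm a b <= 2 -> b = 0 /\ -1 <= a <= 1.
  move=> h; have h4 : 4 * onorm a b = (2 * a + b) * (2 * a + b) + 11 * (b * b).
    by rewrite /onorm; ring.
  have b0 : b = 0 by nia.
  by split=> //; rewrite /onorm b0 in h; nia.
have [Y0 X1] : Y = 0 /\ -1 <= X <= 1 by apply: bound; have := onorm_ge0 z u; lia.
have [u0 z1] : u = 0 /\ -1 <= z <= 1 by apply: bound; have := onorm_ge0 X Y; lia.
have [-> -> -> ->] : [/\ x = 0, y = 0, z = 0 & u = 0] by rewrite /X /Y in X1 Y0; split; lia.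
by rewrite -oelt_int.
Qed.

Lemma herm_ge0 n (L : 'M[algC]_n) x : positive_lattice L -> mx_over_O x ->
  0 <= herm_form L x x.
Proof.
move=> [_ posL] Ox; have [->|x0] := eqVneq x 0; last exact/ltW/posL.
by rewrite /herm_form !mul0mx mxE.
Qed.

Lemma herm_mx22 (p q r s : algC) (c : 'rV[algC]_2) :
  herm_form (mx22 p q r s) c c =
    (c 0 0 * p + c 0 1 * r) * (c 0 0)^* + (c 0 0 * q + c 0 1 * s) * (c 0 1)^*.
Proof.
have c1E : lift ord0 ord0 = 1 :> 'I_2 by apply: val_inj.
rewrite /herm_form mxE !big_ord_recl big_ord0 addr0 !ctE c1E.
by rewrite !mxE !big_ord_recl !big_ord0 /= !addr0 !mxE /= c1E.
Qed.

(** The vector e' is e minus its projection to the plane spanned by F; the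
    projection has integral coefficients s because the plane is unimodular.
    From 0 <= H(e') = 1 - H(s F) and H(s F) = c B^-1 c^* the inner products c
    satisfy [plane_B_inverse_small]. *)
Lemma unit_vector_orthogonal n (L : 'M[algC]_n) (e : 'rV[algC]_n) (F : 'M[algC]_(2, n)) :
  positive_lattice L -> mx_over_O e -> mx_over_O F -> e *m L *m e ^t* = 1%:M ->
  F *m L *m F ^t* = plane_B -> e *m L *m F ^t* = 0.
Proof.
move=> posL Oe OF eLe FLF; have [[OL hL] _] := posL.
pose c := e *m L *m F ^t*; rewrite -/c.
have Oc : mx_over_O c.
  by apply: over_O_mul; [apply: over_O_mul|apply: over_O_ct].
have cE : F *m L *m e ^t* = c ^t* by rewrite /c !ctM trmxCK -hL mulmxA.
pose G := mx22 2%:R (- omega) (- omega^*) 2%:R.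
have OG : mx_over_O G by apply: over_O_mx22; auto with inO.
have hG : G ^t* = G by rewrite ct_mx22; congr mx22; rewrite !conjE ?opprK //; ring.
have w2 := omega_sqr.
have GB : G *m plane_B = 1%:M.
  by rewrite mul_mx22 mx22_1 conj_omega; congr mx22; ring: w2.
pose s := c *m G; pose e' := e - s *m F.
have Oe' : mx_over_O e'.
  move=> i j; rewrite !mxE; apply: inOB => //; apply: inO_sum => k _.
  by apply: inOM => //; apply: over_O_mul.
have e'E : e' *m L *m e' ^t* = 1%:M - c *m G *m c ^t*.
  have -> : e' ^t* = e ^t* - F ^t* *m s ^t*.
    by rewrite -ctM /e' linearB /= map_mxB.
  rewrite mulmxBr !mulmxBl eLe -!(mulmxA s) cE.
  have -> : F *m L *m (F ^t* *m s ^t*) = plane_B *m s ^t* by rewrite mulmxA FLF.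
  have -> : e *m L *m (F ^t* *m s ^t*) = c *m s ^t* by rewrite mulmxA.
  have -> : s *m (plane_B *m s ^t*) = c *m s ^t*.
    by rewrite mulmxA /s -(mulmxA c) GB mulmx1.
  by rewrite subrr subr0.
have [k kE] := herm_real (esym hG) OG Oc.
have k1 : k <= 1.
  have := herm_ge0 posL Oe'; rewrite /herm_form e'E mxE [(1%:M) _ _]mxE eqxx mxE.
  by rewrite -/(herm_form G c c) kE subr_ge0 lerz1.
have [c1 c2] : c 0 0 = 0 /\ c 0 1 = 0.
  apply: (plane_B_inverse_small (k := k)) => //.
  by rewrite -kE herm_mx22; ring.
apply/rowP => j; rewrite [RHS]mxE.
by case: j => [[|[|//]] ?]; [rewrite -[RHS]c1|rewrite -[RHS]c2]; congr (c _ _); apply: val_inj.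
Qed.

Lemma contains_quaternary n (L : 'M[algC]_n) : positive_lattice L ->
  represents L (1%:M : 'M_2) -> represents L plane_B -> represents L quaternary.
Proof.
move=> posL [E [OE EE]] [F [OF FF]]; have [[OL hL] _] := posL.
have EF : E *m L *m F ^t* = 0.
  apply/row_matrixP => i; rewrite !row_mul row0.
  apply: unit_vector_orthogonal => //; first by move=> r s; rewrite mxE.
  apply/matrixP => r s; rewrite !ord1 -[LHS]/(herm_form L (row i E) (row i E)).
  by rewrite -congr_entry -EE !mxE !eqxx.
have FE : F *m L *m E ^t* = 0.
  by have := congr1 (fun M : 'M_2 => M ^t*) EF; rewrite !ctM trmxCK ct0mx -hL mulmxA.
exists (col_mx E F); split; first exact: over_O_col.
rewrite /quaternary tr_col_mx map_row_mx mul_col_mx mul_col_row.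
by rewrite -EE -FF EF FE.
Qed.

Theorem theorem11 (n : nat) (L : 'M[algC]_n)
    (hL : positive_lattice L)
    (h1 : represents L (diag_lattice (\row_(j < 2) (1 : algC))))
    (h2 : represents L (mx22 2%:R omega (omega^*) 2%:R)) :
  two_universal L.
Proof.
split=> // l posl; apply: represents_trans (quaternary_universal posl).
apply: contains_quaternary => //.
have <- : diag_lattice (\row_(j < 2) (1 : algC)) = 1%:M.
  by apply/matrixP => i j; rewrite !mxE.
exact: h1.
Qed.
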